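(* Let $(u_0,u_1)\in\mathcal{N}$ with $u_1>0$. For $\gamma\ge 0$, let $u$ denote the maximal forward solution of the damped focusing Duffing equation $\ddot u+\gamma\dot u+u=u^3$, $(u(0),\dot u(0))=(u_0,u_1)$. (i) If $(u_0,u_1)\in\mathcal{N}_1$, then for every $\gamma\ge0$ the solution $u$ blows up in finite time. In addition, if $\gamma>0$, then the solution enters $\mathcal{K}^-\cap\{u_0>1\}$. (ii) Assume $(u_0,u_1)\in\mathcal{N}_2$. Then there exists $\gamma_0\ge0$ such that: if $0\le\gamma<\gamma_0$, the solution enters $\mathcal{N}_1$ and thus blows up in finite time; if $\gamma=\gamma_0$, then $(u(t),\dot u(t))\to(1,0)$ as $t\to+\infty$ at an exponential rate; if $\gamma>\gamma_0$, then $(u(t),\dot u(t))\to(0,0)$ as $t\to+\infty$ at an exponential rate. If in addition $E(u_0,u_1)=\frac14$, then $\gamma_0=0$. (iii) Assume $(u_0,u_1)\in\mathcal{N}_3$ with $E(u_0,u_1)>\frac14$. Then there exist $\gamma_1>\gamma_0\ge0$ such that: if $0\le\gamma<\gamma_0$, the solution enters $\mathcal{N}_1$ and thus blows up in finite time; if $\gamma=\gamma_0$, then $(u(t),\dot u(t))\to(1,0)$ as $t\to+\infty$ at an exponential rate; if $\gamma_0<\gamma<\gamma_1$, then $(u(t),\dot u(t))\to(0,0)$ as $t\to+\infty$ at an exponential rate; if $\gamma=\gamma_1$, then $(u(t),\dot u(t))\to(-1,0)$ as $t\to+\infty$ at an exponential rate; and if $\gamma>\gamma_1$, the solution enters $\mathcal{K}^-\cap\{u_0<-1\}$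 and therefore blows up in finite time. (iv) Assume $(u_0,u_1)\in\mathcal{N}_3$ with $E(u_0,u_1)=\frac14$. If $\gamma=0$, then $(u(t),\dot u(t))\to(-1,0)$ as $t\to+\infty$ at an exponential rate; if $\gamma>0$, then the solution enters $\mathcal{K}^-\cap\{u_0<-1\}$ and therefore blows up in finite time.
   Context: All functions are real-valued. For $(u_0,u_1)\in\mathbb{R}^2$ set $E(u_0,u_1)=\frac{u_0^2}{2}-\frac{u_0^4}{4}+\frac{u_1^2}{2}$. Define $\mathcal{K}^-=\{(u_0,u_1)\in\mathbb{R}^2: E(u_0,u_1)<\frac14,\ |u_0|>1\}$, $\mathcal{N}=\{(u_0,u_1)\in\mathbb{R}^2: E(u_0,u_1)\ge\frac14\}$, $\mathcal{N}_1=\{(u_0,u_1)\in\mathcal{N}: u_1>0,\ u_0\ge1\}$, $\mathcal{N}_2=\{(u_0,u_1)\in\mathcal{N}: u_1>0,\ -1\le u_0<1\}$, $\mathcal{N}_3=\{(u_0,u_1)\in\mathcal{N}: u_1>0,\ u_0<-1\}$. $\mathcal{K}^-\cap\{u_0>1\}$ and $\mathcal{K}^-\cap\{u_0<-1\}$ denote the subsets of $\mathcal{K}^-$ of points whose first coordinate is $>1$, respectively $<-1$. Let $T^+\in(0,+\infty]$ be the maximal (forward) time of existence of $u$. The solution blows up in finite time if $T^+<+\infty$; it enters a set $S\subset\mathbb{R}^2$ if $(u(t),\dot u(t))\in S$ for some $t\in[0,T^+)$; convergence as $t\to+\infty$ includes the assertion that $T^+=+\infty$. ''At an exponential rate'' means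 that there exist constants $C,c>0$ (possibly depending on the solution) such that the distance to the limit at time $t$ is at most $Ce^{-ct}$ for all $t\ge0$. *)

(* Defs.v *)
From Stdlib Require Import Reals.
From Coquelicot Require Import Coquelicot.
Open Scope R_scope.

Definition energy (x y : R) : R := x ^ 2 / 2 - x ^ 4 / 4 + y ^ 2 / 2.

Definition Kminus (x y : R) : Prop := energy x y < 1 / 4 /\ Rabs x > 1.
Definition Kminus_right (x y : R) : Prop := Kminus x y /\ x > 1.
Definition Kminus_left (x y : R) : Prop := Kminus x y /\ x < -1.

Definition Nset (x y : R) : Prop := energy x y >= 1 / 4.
Definition N1 (x y : R) : Prop := Nset x y /\ y > 0 /\ x >= 1.
Definition N2 (x y : R) : Prop := Nset x y /\ y > 0 /\ -1 <= x < 1.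
Definition N3 (x y : R) : Prop := Nset x y /\ y > 0 /\ x < -1.

Definition forward_interval (T : Rbar) (t : R) : Prop := 0 <= t /\ Rbar_lt t T.

(* [v] is the derivative of [u].  [D_in] is differentiability relative to the
   interval, hence two-sided at interior times and one-sided at time 0; values
   of [u] and [v] outside [0, T) are irrelevant. *)
Definition duffing_solution (gamma u0 u1 : R) (T : Rbar) (u v : R -> R) : Prop :=
  Rbar_lt 0 T /\
  u 0 = u0 /\ v 0 = u1 /\
  forall t, forward_interval T t ->
    D_in u v (forward_interval T) t /\
    exists a : R -> R,
      D_in v a (forward_interval T) t /\
      a t + gamma * v t + u t = u t ^ 3.

Definition maximal_duffing_solution
    (gamma u0 u1 : R) (T : Rbar) (u v : R -> R) : Prop :=
  duffing_solution gamma u0 u1 T u v /\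
  forall (T' : Rbar) (u' v' : R -> R),
    duffing_solution gamma u0 u1 T' u' v' ->
    (forall t, forward_interval T t -> forward_interval T' t /\ u' t = u t) ->
    Rbar_le T' T.

Definition blows_up (T : Rbar) : Prop := Rbar_lt T p_infty.

Definition enters (S : R -> R -> Prop) (T : Rbar) (u v : R -> R) : Prop :=
  exists t, forward_interval T t /\ S (u t) (v t).

Definition converges_exponentially
    (a b : R) (T : Rbar) (u v : R -> R) : Prop :=
  T = p_infty /\
  is_lim u p_infty a /\ is_lim v p_infty b /\
  exists C c : R, C > 0 /\ c > 0 /\
    forall t, t >= 0 ->
      sqrt ((u t - a) ^ 2 + (v t - b) ^ 2) <= C * exp (- c * t).

(* Main.v *)
Require Import Defs.
From Stdlib Require Import Reals Arith Lra Psatz Lia Classical ClassicalEpsilon.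
From Coquelicot Require Import Coquelicot.
Open Scope R_scope.

(** While [v > 0] a trajectory is a graph over the position axis, whose velocity solves
    [dv/du = (u^3 - u) / v - gamma] and decreases strictly with the damping.  The motion to the
    right either crosses a given saddle [a] or stalls at some [x <= a].  Beyond [u = 1] a solution
    blows up.  A stall at [x < -1] happens below the saddle energy, in [Kminus_left], and ends in
    blow-up on the other side; a stall at [|x| < 1] lies in the potential well, where [E + p u v] is
    a Lyapunov function; at a saddle, [E >= 1/4] forces [2 v >= |1 - u^2|], hence exponential
    convergence.  Crossing [a] is an open condition on the damping, it persists when the damping
    decreases and fails when it is large, and at most one damping stalls at [a]: the dampings that
    cross [a] are those below some threshold, which is [gamma0] for [a = 1], [gamma1] for
    [a = -1]. *)

(** * Real analysis *)

Lemma continuous_eps (f : R -> R) (t eps : R) :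
  continuous f t -> 0 < eps ->
  exists d, 0 < d /\ forall s, Rabs (s - t) < d -> Rabs (f s - f t) < eps.
Proof.
  intros f_cont eps_pos.
  destruct (proj1 (filterlim_locally f (f t)) f_cont (mkposreal eps eps_pos)) as [d near].
  exists d; split; [apply cond_pos|exact near].
Qed.

Lemma is_derive_continuous (f : R -> R) (t l : R) : is_derive f t l -> continuous f t.
Proof. intros Df. apply (ex_derive_continuous f). now exists l. Qed.

Lemma continuous_pos_min (f : R -> R) (a b : R) :
  a <= b -> (forall t, a <= t <= b -> continuous f t) ->
  (forall t, a <= t <= b -> 0 < f t) ->
  exists m, 0 < m /\ forall t, a <= t <= b -> m <= f t.
Proof.
  intros le_ab f_cont f_pos.
  destruct (continuity_ab_min f a b le_ab) as [x [min_x x_in]].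
  { intros t t_in. now apply continuity_pt_filterlim, f_cont. }
  exists (f x). split; [now apply f_pos|exact min_x].
Qed.

Lemma continuous_bounded (f : R -> R) (a b : R) :
  a <= b -> (forall t, a <= t <= b -> continuous f t) ->
  exists M, 0 < M /\ forall t, a <= t <= b -> Rabs (f t) <= M.
Proof.
  intros le_ab f_cont.
  destruct (continuity_ab_maj (fun t => Rabs (f t)) a b le_ab) as [x [max_x _]].
  { intros t t_in. apply continuity_pt_filterlim.
    apply (continuous_comp f Rabs); [now apply f_cont|apply continuous_Rabs]. }
  exists (Rabs (f x) + 1). split; [pose proof (Rabs_pos (f x)); lra|].
  intros t t_in. specialize (max_x t t_in). simpl in max_x. lra.
Qed.

Lemma first_hit (f : R -> R) (a b c : R) :
  a <= b -> (forall t, a <= t <= b -> continuous f t) -> c < f a -> f b <= c ->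
  exists t, a < t <= b /\ f t = c /\ forall s, a <= s < t -> c < f s.
Proof.
  intros le_ab f_cont above_a below_b.
  set (above := fun x => a <= x <= b /\ forall s, a <= s <= x -> c < f s).
  assert (above_start : above a).
  { split; [lra|]. intros s s_in. now replace s with a by lra. }
  destruct (completeness above) as [t [ub_t lub_t]].
  { exists b. now intros x [[_ le_xb] _]. }
  { now exists a. }
  assert (le_at : a <= t) by now apply ub_t.
  assert (le_tb : t <= b) by (apply lub_t; now intros x [[_ le_xb] _]).
  assert (before : forall s, a <= s < t -> c < f s).
  { intros s s_in. apply Rnot_le_lt. intros below_s.
    assert (t <= s); [|lra]. apply lub_t. intros x [_ above_x].
    apply Rnot_lt_le. intros lt_sx. specialize (above_x s ltac:(lra)). lra. }
  assert (at_t : f t = c).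
  { destruct (Rtotal_order (f t) c) as [lt_fc|[eq_fc|gt_fc]]; [exfalso|exact eq_fc|exfalso].
    - destruct (continuous_eps f t (c - f t)) as [d [d_pos near]]; [now apply f_cont|lra|].
      assert (lt_at : a < t) by (destruct (Req_dec a t); [subst t|]; lra).
      set (x := Rmax a (t - d / 2)).
      assert (a <= x /\ t - d / 2 <= x) by (split; [apply Rmax_l|apply Rmax_r]).
      assert (x < t) by (apply Rmax_lub_lt; lra).
      specialize (near x ltac:(apply Rabs_def1; lra)). apply Rabs_def2 in near.
      specialize (before x ltac:(lra)). lra.
    - destruct (continuous_eps f t (f t - c)) as [d [d_pos near]]; [now apply f_cont|lra|].
      assert (lt_tb : t < b) by (destruct (Req_dec t b); [subst t|]; lra).
      set (x := Rmin b (t + d / 2)).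
      assert (x <= b /\ x <= t + d / 2) by (split; [apply Rmin_l|apply Rmin_r]).
      assert (t < x) by (apply Rmin_glb_lt; lra).
      assert (x <= t); [|lra]. apply ub_t. split; [lra|].
      intros s s_in. destruct (Rlt_dec s t); [apply before; lra|].
      specialize (near s ltac:(apply Rabs_def1; lra)). apply Rabs_def2 in near. lra. }
  exists t. repeat split; try assumption.
  destruct (Req_dec a t); [subst t|]; lra.
Qed.

Lemma intermediate_value (f : R -> R) (a b c : R) :
  a <= b -> (forall t, a <= t <= b -> continuous f t) -> f a <= c <= f b ->
  exists t, a <= t <= b /\ f t = c.
Proof.
  intros le_ab f_cont [le_ac le_cb].
  destruct (Req_dec (f a) c) as [eq_ac|ne_ac]; [exists a; split; [lra|exact eq_ac]|].
  destruct (first_hit (fun t => - f t) a b (- c)) as [t [t_in [hit _]]]; try lra.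
  { intros t t_in. now apply (continuous_opp f), f_cont. }
  exists t; split; lra.
Qed.

Lemma mean_value (f df : R -> R) (a b : R) :
  a < b -> (forall t, a <= t <= b -> is_derive f t (df t)) ->
  exists c, a < c < b /\ f b - f a = df c * (b - a).
Proof.
  intros lt_ab Df.
  destruct (MVT_cor2 f df a b lt_ab) as [c [slope c_in]]; [|now exists c].
  intros t t_in. now apply is_derive_Reals, Df.
Qed.

Lemma derive_nonneg_le (f df : R -> R) (a b : R) :
  a <= b -> (forall t, a <= t <= b -> is_derive f t (df t)) ->
  (forall t, a < t < b -> 0 <= df t) -> f a <= f b.
Proof.
  intros le_ab Df df_nonneg. destruct (Req_dec a b) as [->|ne_ab]; [lra|].
  destruct (mean_value f df a b) as [c [c_in slope]]; [lra|exact Df|].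
  specialize (df_nonneg c c_in). nra.
Qed.

Lemma derive_pos_lt (f df : R -> R) (a b : R) :
  a < b -> (forall t, a <= t <= b -> is_derive f t (df t)) ->
  (forall t, a < t < b -> 0 < df t) -> f a < f b.
Proof.
  intros lt_ab Df df_pos.
  destruct (mean_value f df a b lt_ab Df) as [c [c_in slope]]. specialize (df_pos c c_in). nra.
Qed.

(* Differentiates an expression in functions whose derivatives are hypotheses of the context. *)
Ltac derive_known :=
  auto_derive;
  [ repeat split; try exact I; try (eexists; eassumption)
  | repeat match goal with
    | Df : is_derive ?f ?t ?l |- context [Derive ?k ?t] =>
        rewrite (is_derive_unique k t l Df)
    end ].

Lemma exp_le (x y : R) : x <= y -> exp x <= exp y.
Proof. intros [lt_xy|<-]; [apply Rlt_le, exp_increasing, lt_xy|apply Rle_refl]. Qed.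

Section Gronwall.

Variables (f df : R -> R) (K a b : R).
Hypothesis le_ab : a <= b.
Hypothesis Df : forall t, a <= t <= b -> is_derive f t (df t).

Lemma is_derive_exp_weight (t : R) :
  a <= t <= b ->
  is_derive (fun s => f s * exp (- (K * s))) t ((df t - K * f t) * exp (- (K * t))).
Proof. intros t_in. pose proof (Df t t_in). derive_known. ring. Qed.

Lemma exp_weight_shift (c x : R) : x * exp (- (K * c)) * exp (K * b) = x * exp (K * (b - c)).
Proof. rewrite Rmult_assoc, <- exp_plus. do 2 f_equal. ring. Qed.

Lemma exp_weight_cancel (x : R) : x * exp (- (K * b)) * exp (K * b) = x.
Proof. rewrite exp_weight_shift, Rminus_diag, Rmult_0_r, exp_0. apply Rmult_1_r. Qed.

Lemma gronwall_ge :
  (forall t, a < t < b -> K * f t <= df t) -> f a * exp (K * (b - a)) <= f b.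
Proof.
  intros growth. rewrite <- exp_weight_shift, <- (exp_weight_cancel (f b)).
  apply Rmult_le_compat_r; [apply Rlt_le, exp_pos|].
  apply (derive_nonneg_le (fun s => f s * exp (- (K * s))) _ a b le_ab is_derive_exp_weight).
  intros t t_in. apply Rmult_le_pos; [specialize (growth t t_in); lra|apply Rlt_le, exp_pos].
Qed.

Lemma gronwall_gt :
  a < b -> (forall t, a < t < b -> K * f t < df t) -> f a * exp (K * (b - a)) < f b.
Proof.
  intros lt_ab growth. rewrite <- exp_weight_shift, <- (exp_weight_cancel (f b)).
  apply Rmult_lt_compat_r; [apply exp_pos|].
  apply (derive_pos_lt (fun s => f s * exp (- (K * s))) _ a b lt_ab is_derive_exp_weight).
  intros t t_in. apply Rmult_lt_0_compat; [specialize (growth t t_in); lra|apply exp_pos].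
Qed.

End Gronwall.

Lemma gronwall_le (f df : R -> R) (K a b : R) :
  a <= b -> (forall t, a <= t <= b -> is_derive f t (df t)) ->
  (forall t, a < t < b -> df t <= K * f t) -> f b <= f a * exp (K * (b - a)).
Proof.
  intros le_ab Df growth. apply Ropp_le_cancel. rewrite Ropp_mult_distr_l.
  apply (gronwall_ge (fun t => - f t) (fun t => - df t) K a b le_ab).
  - intros t t_in. now apply (is_derive_opp f), Df.
  - intros t t_in. specialize (growth t t_in). lra.
Qed.

Lemma gronwall_nonneg (f df : R -> R) (K a b : R) :
  a <= b -> (forall t, a <= t <= b -> is_derive f t (df t)) -> 0 <= f a ->
  (forall t, a < t < b -> f t < 0 -> K * f t <= df t) -> 0 <= f b.
Proof.
  intros le_ab Df nonneg_a growth. apply Rnot_lt_le. intros neg_b.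
  destruct (first_hit (fun t => - f (a + b - t)) a b 0) as [t [t_in [zero neg]]]; try lra.
  - intros t t_in. apply (continuous_opp (fun t => f (a + b - t))).
    apply (continuous_comp (fun t => a + b - t) f).
    + apply (continuous_minus (fun _ => a + b) (fun t => t)).
      * apply continuous_const.
      * apply continuous_id.
    + eapply is_derive_continuous, Df. lra.
  - replace (a + b - a) with b by ring. lra.
  - replace (a + b - b) with a by ring. lra.
  - set (last := a + b - t) in *.
    assert (step : f last * exp (K * (b - last)) <= f b).
    { apply (gronwall_ge f df); [unfold last; lra|intros; apply Df; unfold last in *; lra|].
      intros s s_in. apply growth; [unfold last in *; lra|].
      specialize (neg (a + b - s) ltac:(unfold last in *; lra)).
      replace (a + b - (a + b - s)) with s in neg by ring. lra. }
    replace (f last) with 0 in step by lra. lra.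
Qed.

Lemma gronwall_zero (f df : R -> R) (K a b c : R) :
  a <= c <= b -> (forall t, a <= t <= b -> is_derive f t (df t)) ->
  (forall t, a <= t <= b -> Rabs (df t) <= K * f t) -> f c = 0 ->
  forall t, a <= t <= b -> f t <= 0.
Proof.
  intros c_in Df growth zero t t_in.
  destruct (Rle_dec c t) as [le_ct|lt_tc].
  - replace 0 with (f c * exp (K * (t - c))) by (rewrite zero; ring).
    apply (gronwall_le f df); [exact le_ct|intros; apply Df; lra|].
    intros s s_in. eapply Rle_trans; [apply Rle_abs|apply growth; lra].
  - assert (back : f t * exp (- K * (c - t)) <= f c).
    { apply (gronwall_ge f df); [lra|intros; apply Df; lra|].
      intros s s_in. specialize (growth s ltac:(lra)). apply Rabs_le_between in growth. lra. }
    rewrite zero in back. pose proof (exp_pos (- K * (c - t))).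
    apply Rnot_lt_le. intros pos. nra.
Qed.

Section ExpandingInverse.

Variables (f df : R -> R) (m : R).
Hypothesis m_pos : 0 < m.
Hypothesis Df : forall t, is_derive f t (df t).
Hypothesis df_ge : forall t, m <= df t.

Lemma expanding_le (s t : R) : s <= t -> m * (t - s) <= f t - f s.
Proof.
  intros le_st. cut (f s - m * s <= f t - m * t); [lra|].
  apply (derive_nonneg_le (fun r => f r - m * r) (fun r => df r - m)); [exact le_st| |].
  - intros r _. pose proof (Df r). derive_known. ring.
  - intros r _. specialize (df_ge r). lra.
Qed.

Lemma expanding_abs (s t : R) : m * Rabs (t - s) <= Rabs (f t - f s).
Proof.
  destruct (Rle_dec s t) as [le_st|lt_ts].
  - pose proof (expanding_le s t le_st). rewrite !Rabs_pos_eq; [lra|nra|lra].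
  - pose proof (expanding_le t s ltac:(lra)).
    rewrite (Rabs_minus_sym t), (Rabs_minus_sym (f t)), !Rabs_pos_eq; [lra|nra|lra].
Qed.

Lemma expanding_surjective (x : R) : exists t, f t = x.
Proof.
  set (r := Rabs (x - f 0) / m).
  assert (scale : m * r = Rabs (x - f 0)) by (unfold r; field; lra).
  assert (r_nonneg : 0 <= r) by (apply Rdiv_le_0_compat; [apply Rabs_pos|lra]).
  pose proof (expanding_le (- r) 0 ltac:(lra)). pose proof (expanding_le 0 r r_nonneg).
  assert (bounds : - (m * r) <= x - f 0 <= m * r) by (apply Rabs_le_between; lra).
  destruct (intermediate_value f (- r) r x) as [t [_ hit]]; [lra| |lra|now exists t].
  intros; eapply is_derive_continuous, Df.
Qed.

Lemma is_derive_right_inverse (g : R -> R) (x : R) :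
  (forall y, f (g y) = y) -> is_derive g x (/ df (g x)).
Proof.
  intros fg. apply is_derive_Reals. intros eps eps_pos.
  assert (df_pos : 0 < df (g x)) by (specialize (df_ge (g x)); lra).
  destruct (continuous_eps Rinv (df (g x)) eps) as [d [d_pos inv_near]];
    [apply continuous_Rinv; lra|exact eps_pos|].
  pose proof (Df (g x)) as Dfg. apply is_derive_Reals in Dfg.
  destruct (Dfg d d_pos) as [delta quotient_near].
  assert (radius_pos : 0 < m * delta) by (apply Rmult_lt_0_compat; [exact m_pos|apply cond_pos]).
  exists (mkposreal _ radius_pos). intros h h_ne h_lt. simpl in h_lt.
  set (k := g (x + h) - g x).
  assert (shift : g x + k = g (x + h)) by (unfold k; ring).
  assert (k_ne : k <> 0).
  { intros k0. rewrite k0, Rplus_0_r in shift. apply (f_equal f) in shift.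
    rewrite !fg in shift. lra. }
  assert (k_lt : Rabs k < delta).
  { pose proof (expanding_abs (g x) (g (x + h))) as expands. rewrite !fg in expands.
    fold k in expands. replace (x + h - x) with h in expands by ring. nra. }
  specialize (quotient_near k k_ne k_lt). apply inv_near in quotient_near.
  rewrite shift, !fg in quotient_near.
  replace (k / h) with (/ ((x + h - x) / k)) by (field; split; [lra|exact k_ne]).
  exact quotient_near.
Qed.

Lemma expanding_inverse :
  exists g : R -> R, (forall t, g (f t) = t) /\ (forall x, f (g x) = x) /\
    forall x, is_derive g x (/ df (g x)).
Proof.
  set (g := fun x => proj1_sig (constructive_indefinite_description _ (expanding_surjective x))).
  assert (fg : forall x, f (g x) = x).
  { intros x. unfold g. now destruct constructive_indefinite_description. }
  exists g. split; [|split; [exact fg|intros x; now apply is_derive_right_inverse]].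
  intros t. pose proof (expanding_abs t (g (f t))) as expands.
  rewrite fg, Rminus_diag, Rabs_R0 in expands. apply Rminus_diag_uniq.
  destruct (Req_dec (g (f t) - t) 0) as [|ne]; [assumption|].
  apply Rabs_pos_lt in ne. nra.
Qed.

End ExpandingInverse.

Lemma antitone_open_threshold (P : R -> Prop) (b : R) :
  P 0 -> (forall x, 0 <= x -> P x -> x <= b) ->
  (forall x y, 0 <= x <= y -> P y -> P x) ->
  (forall x, 0 <= x -> P x -> exists d, 0 < d /\ forall y, 0 <= y -> Rabs (y - x) < d -> P y) ->
  exists c, 0 < c /\ forall x, 0 <= x -> (P x <-> x < c).
Proof.
  intros P0 bound antitone P_open.
  destruct (completeness (fun x => 0 <= x /\ P x)) as [c [ub_c lub_c]].
  { exists b. intros x [x_nonneg Px]. now apply bound. }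
  { exists 0. split; [lra|exact P0]. }
  assert (lt_c : forall x, 0 <= x -> P x -> x < c).
  { intros x x_nonneg Px. destruct (P_open x x_nonneg Px) as [d [d_pos near]].
    assert (x + d / 2 <= c); [|lra]. apply ub_c. split; [lra|].
    apply near; [lra|]. apply Rabs_def1; lra. }
  exists c. split; [apply lt_c; [lra|exact P0]|]. intros x x_nonneg.
  split; [now apply lt_c|]. intros lt_x. apply NNPP. intros not_Px.
  assert (c <= x); [|lra]. apply lub_c. intros y [y_nonneg Py].
  apply Rnot_lt_le. intros lt_xy. apply not_Px, (antitone x y); [lra|exact Py].
Qed.

(** * Local solutions as power series *)

Fixpoint course_of_values (F : nat -> (nat -> R) -> R) (n : nat) : nat -> R :=
  match n with
  | O => fun _ => 0
  | S m => fun k => F k (course_of_values F m)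
  end.

Lemma course_of_values_recursion (F : nat -> (nat -> R) -> R) :
  (forall n a b, (forall k, (k < n)%nat -> a k = b k) -> F n a = F n b) ->
  exists a : nat -> R, forall n, a n = F n a.
Proof.
  intros F_local.
  assert (stable : forall m n k, (k < m)%nat -> (k < n)%nat ->
    course_of_values F m k = course_of_values F n k).
  { induction m as [|m IH]; intros [|n] k lt_km lt_kn; try lia.
    apply F_local. intros j lt_jk. apply IH; lia. }
  exists (fun n => course_of_values F (S n) n). intros n.
  apply F_local. intros k lt_kn. apply stable; lia.
Qed.

Lemma PS_mult_ext (a b a' b' : nat -> R) (n : nat) :
  (forall k, (k <= n)%nat -> a k = a' k) -> (forall k, (k <= n)%nat -> b k = b' k) ->
  PS_mult a b n = PS_mult a' b' n.
Proof.
  intros eq_a eq_b. apply sum_eq. intros k le_kn. rewrite eq_a, eq_b by lia. reflexivity.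
Qed.

Lemma PS_mult_geometric (a b : nat -> R) (A B r : R) (n : nat) :
  (forall k, (k <= n)%nat -> Rabs (a k) <= A * r ^ k) ->
  (forall k, (k <= n)%nat -> Rabs (b k) <= B * r ^ k) ->
  Rabs (PS_mult a b n) <= INR (S n) * (A * B) * r ^ n.
Proof.
  intros bound_a bound_b. unfold PS_mult.
  eapply Rle_trans; [apply Rsum_abs|].
  apply Rle_trans with (sum_f_R0 (fun _ => A * B * r ^ n) n); [|rewrite sum_cte; right; ring].
  apply sum_Rle. intros k le_kn. rewrite Rabs_mult.
  replace (r ^ n) with (r ^ k * r ^ (n - k)) by (rewrite <- pow_add; f_equal; lia).
  replace (A * B * (r ^ k * r ^ (n - k))) with (A * r ^ k * (B * r ^ (n - k))) by ring.
  apply Rmult_le_compat; try apply Rabs_pos; [now apply bound_a|apply bound_b; lia].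
Qed.

Lemma CV_radius_geometric (a : nat -> R) (C r t : R) :
  0 < r -> (forall n, Rabs (a n) <= C * r ^ n) -> Rabs t < / r ->
  Rbar_lt (Rabs t) (CV_radius a).
Proof.
  intros r_pos bound t_lt. apply Rbar_lt_le_trans with (/ r); [exact t_lt|].
  apply (proj1 (CV_radius_bounded a)). exists C. intros n.
  rewrite Rabs_mult, <- RPow_abs, (Rabs_pos_eq (/ r)) by (apply Rlt_le, Rinv_0_lt_compat, r_pos).
  rewrite pow_inv.
  apply Rle_trans with (C * r ^ n * / r ^ n).
  - apply Rmult_le_compat_r; [apply Rlt_le, Rinv_0_lt_compat, pow_lt, r_pos|apply bound].
  - right. field. apply pow_nonzero. lra.
Qed.

Definition duffing_at (g : R) (u v : R -> R) (t : R) : Prop :=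
  is_derive u t (v t) /\ is_derive v t (u t ^ 3 - u t - g * v t).

Definition duffing_series (g : R) (a : nat -> R) : Prop :=
  forall n, PS_derive (PS_derive a) n = PS_mult (PS_mult a a) a n - a n - g * PS_derive a n.

Lemma duffing_series_exists (g u0 u1 : R) :
  exists a, a 0%nat = u0 /\ a 1%nat = u1 /\ duffing_series g a.
Proof.
  destruct (course_of_values_recursion (fun n a =>
    match n with
    | O => u0
    | 1%nat => u1
    | S (S k) =>
        (PS_mult (PS_mult a a) a k - a k - g * PS_derive a k) / (INR (S k) * INR (S (S k)))
    end)) as [a rec].
  - intros [|[|n]] a b eq_ab; [reflexivity..|].
    do 2 f_equal; [f_equal|unfold PS_derive; rewrite eq_ab by lia; reflexivity].
    + apply PS_mult_ext; intros k le_kn; [apply PS_mult_ext; intros j le_jk|]; apply eq_ab; lia.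
    + apply eq_ab. lia.
  - exists a. split; [apply (rec 0%nat)|split; [apply (rec 1%nat)|]].
    intros n. unfold PS_derive at 1 2. rewrite (rec (S (S n))). field.
    split; apply not_0_INR; discriminate.
Qed.

Lemma PS_cube_geometric (a : nat -> R) (M r : R) (n : nat) :
  0 <= r -> (forall k, (k <= n)%nat -> Rabs (a k) <= M * r ^ k) ->
  Rabs (PS_mult (PS_mult a a) a n) <= INR (S n) * INR (S (S n)) * (M ^ 2 * (M * r ^ n)).
Proof.
  intros r_nonneg bound.
  replace (INR (S n) * INR (S (S n)) * (M ^ 2 * (M * r ^ n)))
    with (INR (S n) * ((INR (S (S n)) * (M * M)) * M) * r ^ n) by ring.
  apply PS_mult_geometric; intros k le_kn; [|now apply bound].
  eapply Rle_trans; [apply PS_mult_geometric; intros j le_jk; apply bound; lia|].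
  apply Rmult_le_compat_r; [now apply pow_le|].
  apply Rmult_le_compat_r; [nra|]. apply le_INR. lia.
Qed.

(* The factor [(n + 1) (n + 2)] of the second derivative absorbs the number of terms of the cube. *)
Lemma duffing_series_geometric (g M r : R) (a : nat -> R) :
  duffing_series g a -> Rabs (a 0%nat) <= M -> Rabs (a 1%nat) <= M ->
  1 <= r -> M ^ 2 + 1 + Rabs g * r <= r ^ 2 -> forall n, Rabs (a n) <= M * r ^ n.
Proof.
  intros series bound0 bound1 r_ge rate.
  assert (M_nonneg : 0 <= M) by (eapply Rle_trans; [apply Rabs_pos|exact bound0]).
  pose proof (Rabs_pos g).
  induction n as [n IH] using lt_wf_ind.
  destruct n as [|[|n]]; [simpl; lra|simpl; nra|].
  set (b := M * r ^ n).
  assert (b_nonneg : 0 <= b) by (apply Rmult_le_pos; [|apply pow_le]; lra).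
  assert (index_ge : 1 <= INR (S n) /\ 1 <= INR (S (S n))).
  { rewrite !S_INR. pose proof (pos_INR n). lra. }
  set (k := INR (S n) * INR (S (S n))).
  assert (k_ge : INR (S n) <= k /\ 1 <= k) by (unfold k; nra).
  assert (cubic : Rabs (PS_mult (PS_mult a a) a n) <= k * (M ^ 2 * b)).
  { apply PS_cube_geometric; [lra|]. intros j le_jn. apply IH. lia. }
  assert (linear : Rabs (a n) <= k * b).
  { apply Rle_trans with b; [apply IH; lia|nra]. }
  assert (damping : Rabs (g * (INR (S n) * a (S n))) <= k * (Rabs g * r * b)).
  { rewrite !Rabs_mult, (Rabs_pos_eq (INR (S n))) by lra.
    replace (k * (Rabs g * r * b)) with (Rabs g * (k * (r * b))) by ring.
    apply Rmult_le_compat_l; [lra|]. apply Rmult_le_compat; [lra|apply Rabs_pos|lra|].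
    replace (r * b) with (M * r ^ S n) by (unfold b; simpl; ring). apply IH. lia. }
  apply Rmult_le_reg_l with k; [lra|].
  rewrite <- (Rabs_pos_eq k) at 1 by lra. rewrite <- Rabs_mult. unfold k at 1.
  specialize (series n). unfold PS_derive in series. rewrite Rmult_assoc, series.
  replace (M * r ^ S (S n)) with (r ^ 2 * b) by (unfold b; simpl; ring).
  assert (k * ((M ^ 2 + 1 + Rabs g * r) * b) <= k * (r ^ 2 * b)).
  { apply Rmult_le_compat_l; [lra|]. now apply Rmult_le_compat_r. }
  apply Rabs_le_between in cubic. apply Rabs_le_between in linear.
  apply Rabs_le_between in damping. apply Rabs_le. lra.
Qed.

Lemma INR_S_le_pow2 (n : nat) : INR (S n) <= 2 ^ n.
Proof.
  induction n as [|n IH]; [simpl; lra|].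
  rewrite S_INR. pose proof (pow_R1_Rle 2 n ltac:(lra)). simpl pow. lra.
Qed.

Lemma duffing_series_solution (g M r t : R) (a : nat -> R) :
  duffing_series g a -> 0 < r -> (forall n, Rabs (a n) <= M * r ^ n) -> Rabs t < / (2 * r) ->
  duffing_at g (PSeries a) (PSeries (PS_derive a)) t.
Proof.
  intros series r_pos bound t_lt.
  assert (radius : Rbar_lt (Rabs t) (CV_radius a)).
  { apply (CV_radius_geometric a M r t r_pos bound).
    eapply Rlt_trans; [exact t_lt|]. apply Rinv_lt_contravar; nra. }
  assert (radius_sq : Rbar_lt (Rabs t) (CV_radius (PS_mult a a))).
  { apply (CV_radius_geometric _ (M * M) (2 * r) t); [lra| |exact t_lt].
    intros n. rewrite Rpow_mult_distr.
    eapply Rle_trans; [apply (PS_mult_geometric a a M M r n); intros; apply bound|].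
    rewrite <- (Rmult_assoc (M * M)). apply Rmult_le_compat_r; [apply pow_le; lra|].
    rewrite Rmult_comm. apply Rmult_le_compat_l; [nra|apply INR_S_le_pow2]. }
  split; [now apply is_derive_PSeries|].
  assert (radius' : Rbar_lt (Rabs t) (CV_radius (PS_derive a))) by now rewrite CV_radius_derive.
  replace (PSeries a t ^ 3 - PSeries a t - g * PSeries (PS_derive a) t)
    with (PSeries (PS_derive (PS_derive a)) t); [now apply is_derive_PSeries|].
  pose proof (CV_radius_inside a t radius) as conv.
  pose proof (ex_pseries_mult _ a t radius_sq radius) as conv_cube.
  pose proof (CV_radius_inside _ t radius') as conv'.
  rewrite (PSeries_ext _ (PS_minus (PS_minus (PS_mult (PS_mult a a) a) a)
    (PS_scal g (PS_derive a)))) by apply series.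
  rewrite PSeries_minus, PSeries_minus, PSeries_scal, PSeries_mult, PSeries_mult;
    try assumption.
  - ring.
  - now apply ex_pseries_minus.
  - apply ex_pseries_scal; [apply Rmult_comm|exact conv'].
Qed.

Lemma duffing_local (g M : R) :
  exists d, 0 < d /\ forall u0 u1, Rabs u0 <= M -> Rabs u1 <= M ->
    exists u v : R -> R, u 0 = u0 /\ v 0 = u1 /\ forall t, Rabs t <= d -> duffing_at g u v t.
Proof.
  set (r := M ^ 2 + 1 + Rabs g).
  pose proof (pow2_ge_0 M). pose proof (Rabs_pos g).
  assert (r_ge : 1 <= r) by (unfold r; lra). assert (r_pos : 0 < r) by lra.
  assert (radius_pos : 0 < / (2 * r)) by (apply Rinv_0_lt_compat; lra).
  exists (/ (2 * r) / 2). split; [lra|]. intros u0 u1 bound0 bound1.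
  destruct (duffing_series_exists g u0 u1) as [a [start [slope series]]].
  exists (PSeries a), (PSeries (PS_derive a)). rewrite !PSeries_0.
  split; [exact start|split; [unfold PS_derive; simpl; lra|]].
  intros t t_le. apply (duffing_series_solution g M r t a series r_pos); [|lra].
  apply (duffing_series_geometric g); try assumption; [now rewrite start|now rewrite slope|].
  unfold r in *. nra.
Qed.

(** * Uniqueness, continuation and complete solutions *)

Lemma duffing_at_ext_interval (g : R) (u v x y : R -> R) (a b t : R) :
  a < t < b -> (forall s, a < s < b -> x s = u s /\ y s = v s) ->
  duffing_at g x y t -> duffing_at g u v t.
Proof.
  intros t_in same [Dx Dy]. destruct (same t t_in) as [eq_x eq_y].
  rewrite eq_x, eq_y in *.
  split; (eapply is_derive_ext_loc; [|eassumption]);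
    apply (locally_interval _ t a b); simpl; try apply t_in; intros; now apply same.
Qed.

Lemma duffing_at_shift (g s t : R) (u v : R -> R) :
  duffing_at g u v (t - s) -> duffing_at g (fun r => u (r - s)) (fun r => v (r - s)) t.
Proof.
  intros [Du Dv].
  assert (shift : is_derive (fun r => r - s) t 1) by (auto_derive; [exact I|ring]).
  split.
  - rewrite <- (Rmult_1_l (v (t - s))). exact (is_derive_comp u _ t _ 1 Du shift).
  - rewrite <- (Rmult_1_l (_ - _)). exact (is_derive_comp v _ t _ 1 Dv shift).
Qed.

Lemma duffing_at_opp (g t : R) (u v : R -> R) :
  duffing_at g u v t -> duffing_at g (fun r => - u r) (fun r => - v r) t.
Proof. intros [Du Dv]. split; derive_known; ring. Qed.

Lemma duffing_at_continuous (g t : R) (u v : R -> R) :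
  duffing_at g u v t -> continuous u t /\ continuous v t.
Proof. intros [Du Dv]. split; eapply is_derive_continuous; eassumption. Qed.

Lemma duffing_at_bounded (g a b : R) (u v : R -> R) :
  a <= b -> (forall t, a <= t <= b -> duffing_at g u v t) ->
  exists M, 0 < M /\ forall t, a <= t <= b -> Rabs (u t) <= M /\ Rabs (v t) <= M.
Proof.
  intros le_ab flow.
  destruct (continuous_bounded u a b le_ab) as [Mu [Mu_pos bound_u]].
  { intros t t_in. now apply (duffing_at_continuous g t u v), flow. }
  destruct (continuous_bounded v a b le_ab) as [Mv [Mv_pos bound_v]].
  { intros t t_in. now apply (duffing_at_continuous g t u v), flow. }
  exists (Mu + Mv). split; [lra|]. intros t t_in.
  specialize (bound_u t t_in). specialize (bound_v t t_in). lra.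
Qed.

Lemma Rabs_quadratic_form_le (p q c g C : R) :
  Rabs c <= C -> Rabs (2 * p * q * c - 2 * g * q ^ 2) <= (C + 2 * Rabs g) * (p ^ 2 + q ^ 2).
Proof.
  intros c_le. unfold Rminus. eapply Rle_trans; [apply Rabs_triang|].
  rewrite Rabs_Ropp, !Rabs_mult, (Rabs_pos_eq 2), (Rabs_pos_eq (q ^ 2)) by
    (try apply pow2_ge_0; lra).
  rewrite <- (pow2_abs p), <- (pow2_abs q).
  pose proof (Rabs_pos p). pose proof (Rabs_pos q).
  pose proof (Rabs_pos g). pose proof (Rabs_pos c).
  assert (2 * Rabs p * Rabs q <= Rabs p ^ 2 + Rabs q ^ 2).
  { pose proof (pow2_ge_0 (Rabs p - Rabs q)). lra. }
  assert (2 * Rabs p * Rabs q * Rabs c <= (Rabs p ^ 2 + Rabs q ^ 2) * C)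
    by (apply Rmult_le_compat; try assumption; nra).
  assert (0 <= Rabs g * Rabs p ^ 2) by (apply Rmult_le_pos; [|apply pow2_ge_0]; lra).
  lra.
Qed.

Lemma duffing_at_unique (g a b c : R) (u v x y : R -> R) :
  a <= c <= b -> (forall t, a <= t <= b -> duffing_at g u v t) ->
  (forall t, a <= t <= b -> duffing_at g x y t) -> u c = x c -> v c = y c ->
  forall t, a <= t <= b -> u t = x t /\ v t = y t.
Proof.
  intros c_in flow flow' eq_u eq_v t t_in.
  destruct (duffing_at_bounded g a b u v ltac:(lra) flow) as [M [M_pos bound]].
  destruct (duffing_at_bounded g a b x y ltac:(lra) flow') as [M' [M'_pos bound']].
  set (sq := fun s => (u s - x s) ^ 2 + (v s - y s) ^ 2).
  set (dsq := fun s => 2 * (u s - x s) * (v s - y s) * (u s ^ 2 + u s * x s + x s ^ 2)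
    - 2 * g * (v s - y s) ^ 2).
  set (C := M ^ 2 + M * M' + M' ^ 2).
  assert (sq_le : sq t <= 0).
  { apply (gronwall_zero sq dsq (C + 2 * Rabs g) a b c c_in); [| | |exact t_in].
    - intros s s_in. destruct (flow s s_in) as [Du Dv]. destruct (flow' s s_in) as [Dx Dy].
      unfold sq, dsq. derive_known. ring.
    - intros s s_in. apply Rabs_quadratic_form_le.
      destruct (bound s s_in) as [u_le _]. destruct (bound' s s_in) as [x_le _].
      apply Rabs_le_between in u_le. apply Rabs_le_between in x_le.
      unfold C. apply Rabs_le. split; nra.
    - unfold sq. rewrite eq_u, eq_v. ring. }
  unfold sq in sq_le. pose proof (pow2_ge_0 (u t - x t)). pose proof (pow2_ge_0 (v t - y t)).
  split; apply Rminus_diag_uniq, Rsqr_0_uniq; rewrite Rsqr_pow2; lra.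
Qed.

Lemma extension_cont_left (f h : R -> R) (s t : R) : t <= s -> extension_cont f h s t = f t.
Proof. intros le_ts. unfold extension_cont. now destruct Rle_dec. Qed.

Lemma extension_cont_right (f h : R -> R) (s t : R) : s < t -> extension_cont f h s t = h t.
Proof. intros lt_st. unfold extension_cont. destruct Rle_dec; [lra|reflexivity]. Qed.

Lemma duffing_at_glue (g s t : R) (u v x y : R -> R) :
  u s = x s -> v s = y s -> (t <= s -> duffing_at g u v t) -> (s <= t -> duffing_at g x y t) ->
  duffing_at g (extension_cont u x s) (extension_cont v y s) t.
Proof.
  intros eq_u eq_v flow_le flow_ge. destruct (Rtotal_order t s) as [lt_ts|[->|lt_st]].
  - apply (duffing_at_ext_interval g _ _ u v (t - 1) s); [lra| |apply flow_le; lra].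
    intros r r_in. now rewrite !extension_cont_left by lra.
  - destruct (flow_le (Rle_refl s)) as [Du Dv]. destruct (flow_ge (Rle_refl s)) as [Dx Dy].
    rewrite <- eq_u, <- eq_v in Dy. rewrite <- eq_v in Dx.
    split; rewrite !(extension_cont_left _ _ s s (Rle_refl s));
      now apply (extension_cont_is_derive (V := R_NormedModule)).
  - apply (duffing_at_ext_interval g _ _ x y s (t + 1)); [lra| |apply flow_ge; lra].
    intros r r_in. now rewrite !extension_cont_right by lra.
Qed.

Lemma duffing_extend (g tau M : R) (u v : R -> R) :
  0 < tau -> (forall t, 0 <= t < tau -> duffing_at g u v t) ->
  (forall t, 0 <= t < tau -> Rabs (u t) <= M /\ Rabs (v t) <= M) ->
  exists (tau' : R) (u' v' : R -> R), tau < tau' /\ u' 0 = u 0 /\ v' 0 = v 0 /\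
    forall t, t <= tau' -> (t < tau -> duffing_at g u v t) -> duffing_at g u' v' t.
Proof.
  intros tau_pos flow bound. destruct (duffing_local g M) as [d [d_pos local]].
  set (s := Rmax 0 (tau - d / 2)).
  assert (0 <= s /\ tau - d / 2 <= s) as [s_nonneg s_ge] by (split; [apply Rmax_l|apply Rmax_r]).
  assert (s_lt : s < tau) by (apply Rmax_lub_lt; lra).
  destruct (bound s (conj s_nonneg s_lt)) as [bound_u bound_v].
  destruct (local (u s) (v s) bound_u bound_v) as [x [y [start [slope flow_xy]]]].
  exists (s + d), (extension_cont u (fun t => x (t - s)) s),
    (extension_cont v (fun t => y (t - s)) s).
  split; [lra|]. rewrite !extension_cont_left by exact s_nonneg.
  split; [reflexivity|]. split; [reflexivity|]. intros t t_le flow_t. apply duffing_at_glue.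
  - now rewrite Rminus_diag.
  - now rewrite Rminus_diag.
  - intros le_ts. apply flow_t. lra.
  - intros le_st. apply duffing_at_shift, flow_xy, Rabs_le. lra.
Qed.

Lemma forward_interval_le (T : Rbar) (s t : R) :
  0 <= s <= t -> forward_interval T t -> forward_interval T s.
Proof. intros s_in [_ lt_tT]. split; [lra|]. now apply (Rbar_le_lt_trans s t T). Qed.

Record complete_flow (g u0 u1 : R) (T : Rbar) (u v : R -> R) : Prop := {
  flow_time_pos : Rbar_lt 0 T;
  flow_position0 : u 0 = u0;
  flow_velocity0 : v 0 = u1;
  flow_duffing : forall t, forward_interval T t -> duffing_at g u v t;
  flow_global : forall M,
    (forall t, forward_interval T t -> Rabs (u t) <= M /\ Rabs (v t) <= M) -> T = p_infty
}.

Arguments flow_time_pos {g u0 u1 T u v}.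
Arguments flow_position0 {g u0 u1 T u v}.
Arguments flow_velocity0 {g u0 u1 T u v}.
Arguments flow_duffing {g u0 u1 T u v}.
Arguments flow_global {g u0 u1 T u v}.

(* The neighbourhood of time 0 makes any two solutions coincide around every point of their
   common domain. *)
Definition solves_until (g u0 u1 d t : R) (u v : R -> R) : Prop :=
  u 0 = u0 /\ v 0 = u1 /\ forall r, - d < r <= t -> duffing_at g u v r.

Lemma solves_until_unique (g u0 u1 d r t : R) (u v x y : R -> R) :
  - d < t <= r -> 0 < d -> solves_until g u0 u1 d r u v ->
  solves_until g u0 u1 d (Rmax 0 t) x y -> 0 <= r -> u t = x t /\ v t = y t.
Proof.
  intros t_in d_pos [start [slope flow]] [start' [slope' flow']] r_nonneg.
  pose proof (Rmax_l 0 t). pose proof (Rmax_r 0 t). pose proof (Rmin_l 0 t).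
  assert (- d < Rmin 0 t) by (apply Rmin_glb_lt; lra).
  assert (Rmax 0 t <= r) by (apply Rmax_lub; lra).
  apply (duffing_at_unique g (Rmin 0 t) (Rmax 0 t) 0 u v x y).
  - lra.
  - intros q q_in. apply flow. lra.
  - intros q q_in. apply flow'. lra.
  - now rewrite start.
  - now rewrite slope.
  - split; [apply Rmin_r|assumption].
Qed.

Lemma solves_until_patch (g u0 u1 d : R) :
  0 < d -> exists U V : R -> R, forall r t u v, 0 <= t -> t < r ->
    solves_until g u0 u1 d r u v -> solves_until g u0 u1 d t U V.
Proof.
  intros d_pos.
  set (W := fun t => epsilon (inhabits (fun _ : R => 0, fun _ : R => 0))
    (fun w => solves_until g u0 u1 d (Rmax 0 t) (fst w) (snd w))).
  exists (fun t => fst (W t) t), (fun t => snd (W t) t).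
  intros r t u v t_nonneg lt_tr solves. assert (solves' := solves).
  destruct solves' as [start [slope flow]].
  assert (agree : forall s, - d < s <= r -> u s = fst (W s) s /\ v s = snd (W s) s).
  { intros s s_in. apply (solves_until_unique g u0 u1 d r s u v); try assumption; [|lra].
    unfold W. apply (epsilon_spec _ (fun w => solves_until g u0 u1 d _ (fst w) (snd w))).
    exists (u, v). split; [exact start|split; [exact slope|]].
    intros q q_in. apply flow. assert (Rmax 0 s <= r) by (apply Rmax_lub; lra). simpl. lra. }
  destruct (agree 0 ltac:(lra)) as [eq_u eq_v].
  split; [lra|split; [lra|]]. intros s s_in.
  apply (duffing_at_ext_interval g _ _ u v (- d) r); [lra| |apply flow; lra].
  intros q q_in. apply agree. lra.
Qed.

Lemma complete_flow_exists (g u0 u1 : R) : exists T u v, complete_flow g u0 u1 T u v.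
Proof.
  destruct (duffing_local g (Rmax (Rabs u0) (Rabs u1))) as [d [d_pos local]].
  destruct (local u0 u1 (Rmax_l _ _) (Rmax_r _ _)) as [x [y [start [slope flow_xy]]]].
  destruct (solves_until_patch g u0 u1 d d_pos) as [U [V patch]].
  set (reached := fun t => 0 <= t /\ exists u v, solves_until g u0 u1 d t u v).
  destruct (Lub_Rbar_correct reached) as [ub_T lub_T]. set (T := Lub_Rbar reached) in *.
  assert (below : forall t, forward_interval T t ->
    exists r u v, t < r /\ 0 <= r /\ solves_until g u0 u1 d r u v).
  { intros t [t_nonneg lt_tT]. apply NNPP. intros none. apply (Rbar_lt_not_le _ _ lt_tT).
    apply lub_T. intros r [r_nonneg [u [v solves]]]. apply Rnot_lt_le. intros lt_tr.
    apply none. now exists r, u, v. }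
  assert (start_in : forward_interval T 0).
  { split; [lra|]. apply Rbar_lt_le_trans with d; [exact d_pos|]. apply ub_T.
    split; [lra|]. exists x, y. split; [exact start|split; [exact slope|]].
    intros r r_in. apply flow_xy, Rabs_le. lra. }
  assert (solves_all : Rbar_lt 0 T /\ forall r, 0 <= r -> Rbar_lt r T ->
    solves_until g u0 u1 d r U V).
  { split; [apply start_in|]. intros t t_nonneg lt_tT.
    destruct (below t (conj t_nonneg lt_tT)) as [r [u [v [lt_tr [r_nonneg solves]]]]].
    exact (patch r t u v t_nonneg lt_tr solves). }
  destruct solves_all as [T_pos solves_all].
  destruct (solves_all 0 (Rle_refl 0) T_pos) as [initial_u [initial_v flow0]].
  exists T, U, V. split; try assumption.
  - intros t [t_nonneg lt_tT]. apply (solves_all t t_nonneg lt_tT). lra.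
  - intros M bound.
    destruct T as [tau| |]; [exfalso|reflexivity|contradiction T_pos]. simpl in T_pos.
    destruct (duffing_extend g tau M U V) as [tau' [u [v [lt_tau [u_start [v_start flow_uv]]]]]].
    + exact T_pos.
    + intros t t_in. apply (solves_all t); simpl; lra.
    + intros t t_in. apply bound. split; simpl; lra.
    + assert (over : reached tau').
      { split; [lra|]. exists u, v. split; [lra|split; [lra|]].
        intros r r_in. apply flow_uv; [lra|]. intros lt_r.
        destruct (Rle_dec r 0); [apply flow0; lra|]. apply (solves_all r); simpl; lra. }
      specialize (ub_T _ over). simpl in ub_T. lra.
Qed.

Lemma is_derive_D_in (f d : R -> R) (D : R -> Prop) (t : R) :
  is_derive f t (d t) -> D_in f d D t.
Proof.
  intros Df. apply is_derive_Reals, derivable_pt_lim_D_in in Df.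
  intros eps eps_pos. destruct (Df eps eps_pos) as [delta [delta_pos near]].
  exists delta. split; [exact delta_pos|].
  intros x [[_ ne] dist]. apply near. split; [split; [exact I|exact ne]|exact dist].
Qed.

Lemma duffing_at_solution (g : R) (T : Rbar) (u v : R -> R) :
  Rbar_lt 0 T -> (forall t, forward_interval T t -> duffing_at g u v t) ->
  duffing_solution g (u 0) (v 0) T u v.
Proof.
  intros T_pos flow. split; [exact T_pos|]. split; [reflexivity|]. split; [reflexivity|].
  intros t t_in. destruct (flow t t_in) as [Du Dv]. split; [now apply is_derive_D_in|].
  exists (fun t => u t ^ 3 - u t - g * v t). split; [now apply is_derive_D_in|ring].
Qed.

(* [D_in] is one-sided at time 0; the continuation makes the derivative there two-sided. *)
Definition linear_continuation (w : R -> R) (c : R) : R -> R :=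
  extension_cont (fun t => w 0 + c * t) w 0.

Lemma linear_continuation_nonneg (w : R -> R) (c t : R) :
  0 <= t -> linear_continuation w c t = w t.
Proof.
  intros t_nonneg. unfold linear_continuation. destruct (Req_dec t 0) as [->|ne].
  - rewrite extension_cont_left by lra. ring.
  - apply extension_cont_right. lra.
Qed.

Lemma is_derive_linear_continuation (w d : R -> R) (c t : R) (T : Rbar) :
  forward_interval T t -> D_in w d (forward_interval T) t -> (t = 0 -> c = d t) ->
  is_derive (linear_continuation w c) t (d t).
Proof.
  intros t_in Dw slope. apply is_derive_Reals. intros eps eps_pos.
  destruct (Dw eps eps_pos) as [a [a_pos near]].
  destruct (Rbar_lt_locally (if Req_EM_T t 0 then m_infty else 0) T t) as [r in_domain].
  { destruct t_in as [[lt_0t|<-] _]; destruct Req_EM_T; simpl; try exact I; lra. }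
  { apply t_in. }
  assert (radius_pos : 0 < Rmin a r) by (apply Rmin_glb_lt; [exact a_pos|apply cond_pos]).
  exists (mkposreal _ radius_pos). intros h h_ne h_lt. simpl in h_lt.
  rewrite (linear_continuation_nonneg w c t) by apply t_in.
  destruct (in_domain (t + h)) as [right_of lt_T].
  { replace (t + h - t) with h by ring. eapply Rlt_le_trans; [exact h_lt|apply Rmin_r]. }
  destruct (Rle_dec 0 (t + h)) as [th_nonneg|th_neg].
  - rewrite linear_continuation_nonneg by exact th_nonneg.
    replace h with (t + h - t) at 2 by ring. apply near.
    split; [split; [now split|lra]|]. simpl. unfold Rdist.
    replace (t + h - t) with h by ring. eapply Rlt_le_trans; [exact h_lt|apply Rmin_l].
  - destruct (Req_EM_T t 0) as [->|_]; [|simpl in right_of; lra].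
    unfold linear_continuation. rewrite extension_cont_left, <- slope by (reflexivity || lra).
    replace ((w 0 + c * (0 + h) - w 0) / h - c) with 0 by (field; exact h_ne).
    now rewrite Rabs_R0.
Qed.

Lemma duffing_solution_two_sided (g u0 u1 : R) (T : Rbar) (u v : R -> R) :
  duffing_solution g u0 u1 T u v ->
  exists u' v' : R -> R, (forall t, 0 <= t -> u' t = u t /\ v' t = v t) /\
    forall t, forward_interval T t -> duffing_at g u' v' t.
Proof.
  intros [_ [start [slope solves]]].
  exists (linear_continuation u u1), (linear_continuation v (u0 ^ 3 - u0 - g * u1)).
  assert (same : forall t, 0 <= t -> linear_continuation u u1 t = u t /\
    linear_continuation v (u0 ^ 3 - u0 - g * u1) t = v t).
  { intros t t_nonneg. now rewrite !linear_continuation_nonneg. }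
  split; [exact same|]. intros t t_in. unfold duffing_at.
  destruct (same t (proj1 t_in)) as [-> ->].
  destruct (solves t t_in) as [Du [a [Dv ode]]]. split.
  - apply (is_derive_linear_continuation u v u1 t T t_in Du). intros ->. now symmetry.
  - replace (u t ^ 3 - u t - g * v t) with (a t) by lra.
    apply (is_derive_linear_continuation v a _ t T t_in Dv).
    intros ->. rewrite <- start, <- slope. lra.
Qed.

Lemma maximal_complete_flow (g u0 u1 : R) (T : Rbar) (u v : R -> R) :
  maximal_duffing_solution g u0 u1 T u v ->
  exists u' v', complete_flow g u0 u1 T u' v' /\ forall t, 0 <= t -> u' t = u t /\ v' t = v t.
Proof.
  intros [solution maximal].
  destruct (duffing_solution_two_sided g u0 u1 T u v solution) as [u' [v' [same flow]]].
  destruct solution as [T_pos [start [slope _]]].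
  destruct (same 0 (Rle_refl 0)) as [start' slope'].
  rewrite start in start'. rewrite slope in slope'.
  exists u', v'. split; [|exact same]. split; try assumption. intros M bound.
  destruct T as [tau| |]; [exfalso|reflexivity|contradiction T_pos]. simpl in T_pos.
  destruct (duffing_extend g tau M u' v' T_pos) as [tau' [x [y [lt_tau [x0 [y0 flow_xy]]]]]].
  { intros t t_in. apply flow. split; simpl; lra. }
  { intros t t_in. apply bound. split; simpl; lra. }
  assert (flow_long : forall t, 0 <= t <= tau' -> duffing_at g x y t).
  { intros t t_in. apply flow_xy; [lra|]. intros lt_t. apply flow. split; simpl; lra. }
  assert (le_T : Rbar_le tau' tau); [|simpl in le_T; lra].
  apply (maximal tau' x y).
  - rewrite <- start', <- slope', <- x0, <- y0.
    apply duffing_at_solution; [simpl; lra|].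
    intros t [t_nonneg t_lt]. apply flow_long. simpl in t_lt. lra.
  - intros t [t_nonneg t_lt]. simpl in t_lt.
    split; [split; [exact t_nonneg|simpl; lra]|].
    destruct (same t t_nonneg) as [<- _].
    apply (duffing_at_unique g 0 t 0 x y u' v'); try lra; intros q q_in.
    + apply flow_long. lra.
    + apply flow. split; simpl; lra.
Qed.

(** * Energy *)

Definition saddle (a : R) : Prop := a = 1 \/ a = -1.

Lemma saddle_sqr (a : R) : a ^ 2 = 1 <-> saddle a.
Proof.
  split; [intros sq; unfold saddle; assert (prod : (a - 1) * (a + 1) = 0) by lra|].
  - apply Rmult_integral in prod. lra.
  - intros [-> | ->]; ring.
Qed.

Lemma energy_sqr (x y : R) : energy x y = 1 / 4 - (1 - x ^ 2) ^ 2 / 4 + y ^ 2 / 2.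
Proof. unfold energy. field. Qed.

Lemma energy_opp (x y : R) : energy (- x) (- y) = energy x y.
Proof. unfold energy. field. Qed.

Lemma energy_saddle (a y : R) : saddle a -> energy a y = 1 / 4 + y ^ 2 / 2.
Proof. intros sad. rewrite energy_sqr, (proj2 (saddle_sqr a) sad). field. Qed.

Lemma energy_rest_lt (x : R) : ~ saddle x -> energy x 0 < 1 / 4.
Proof.
  intros not_saddle. rewrite energy_sqr.
  assert (0 < (1 - x ^ 2) ^ 2); [|lra].
  rewrite <- Rsqr_pow2. apply Rsqr_pos_lt. intros zero. apply not_saddle, saddle_sqr. lra.
Qed.

Lemma energy_rest_le (x : R) : energy x 0 <= 1 / 4.
Proof. rewrite energy_sqr. pose proof (pow2_ge_0 (1 - x ^ 2)). lra. Qed.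

Lemma velocity_lower_bound (x y : R) :
  1 / 4 <= energy x y -> 0 <= y -> Rabs (1 - x ^ 2) <= 2 * y.
Proof.
  rewrite energy_sqr, <- (pow2_abs (1 - x ^ 2)). intros high y_nonneg.
  pose proof (Rabs_pos (1 - x ^ 2)). apply Rnot_lt_le. intros slow. nra.
Qed.

Lemma velocity_upper_bound (x y e r : R) :
  energy x y <= e -> Rabs x <= r -> Rabs y <= 2 * Rabs e + r ^ 4 + 1.
Proof.
  intros low x_le. pose proof (Rle_abs e). pose proof (Rabs_pos y).
  assert (x ^ 4 <= r ^ 4).
  { replace (x ^ 4) with (Rabs x ^ 4).
    - apply pow_incr. split; [apply Rabs_pos|exact x_le].
    - replace (Rabs x ^ 4) with ((Rabs x ^ 2) ^ 2) by ring. rewrite pow2_abs. ring. }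
  assert (0 <= x ^ 4) by (replace (x ^ 4) with ((x ^ 2) ^ 2) by ring; apply pow2_ge_0).
  unfold energy in low. pose proof (pow2_ge_0 x). rewrite <- (pow2_abs y) in low. nra.
Qed.

Lemma is_derive_energy (g t : R) (u v : R -> R) :
  duffing_at g u v t -> is_derive (fun s => energy (u s) (v s)) t (- g * v t ^ 2).
Proof. intros [Du Dv]. unfold energy. derive_known. field. Qed.

Lemma energy_nonincreasing (g s t : R) (u v : R -> R) :
  0 <= g -> s <= t -> (forall r, s <= r <= t -> duffing_at g u v r) ->
  energy (u t) (v t) <= energy (u s) (v s).
Proof.
  intros g_nonneg le_st flow. apply Ropp_le_cancel.
  apply (derive_nonneg_le (fun r => - energy (u r) (v r)) (fun r => - (- g * v r ^ 2)));
    [exact le_st| |].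
  - intros r r_in. apply (is_derive_opp (fun r => energy (u r) (v r))).
    now apply is_derive_energy, flow.
  - intros r _. pose proof (pow2_ge_0 (v r)). nra.
Qed.

Lemma position_increasing (g s t : R) (u v : R -> R) :
  s < t -> (forall r, s <= r <= t -> duffing_at g u v r) ->
  (forall r, s < r < t -> 0 < v r) -> u s < u t.
Proof.
  intros lt_st flow v_pos. apply (derive_pos_lt u v s t lt_st); [|exact v_pos].
  intros r r_in. apply (flow r r_in).
Qed.

Lemma bounded_position_global (g u0 u1 M : R) (T : Rbar) (u v : R -> R) :
  complete_flow g u0 u1 T u v -> 0 <= g ->
  (forall t, forward_interval T t -> Rabs (u t) <= M) -> T = p_infty.
Proof.
  intros flow g_nonneg bound.
  apply (flow_global flow (M + (2 * Rabs (energy u0 u1) + M ^ 4 + 1))).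
  intros t t_in. specialize (bound t t_in).
  assert (Rabs (v t) <= 2 * Rabs (energy u0 u1) + M ^ 4 + 1).
  { apply (velocity_upper_bound (u t)); [|exact bound].
    rewrite <- (flow_position0 flow), <- (flow_velocity0 flow).
    apply (energy_nonincreasing g); [exact g_nonneg|apply t_in|].
    intros r r_in. apply (flow_duffing flow). now apply forward_interval_le with t. }
  pose proof (Rabs_pos (u t)). pose proof (Rabs_pos (v t)). lra.
Qed.

(** * Blow-up *)

Lemma outward_invariant (g s t : R) (u v : R -> R) :
  s <= t -> (forall r, s <= r <= t -> duffing_at g u v r) -> 1 <= u s -> 0 < v s -> 0 < v t.
Proof.
  intros le_st flow u_ge v_pos. apply Rnot_le_lt. intros v_nonpos.
  destruct (first_hit v s t 0 le_st) as [r [r_in [zero moving]]]; try lra.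
  { intros q q_in. now apply (duffing_at_continuous g q u v), flow. }
  assert (grow : v s * exp (- g * (r - s)) <= v r).
  { apply (gronwall_ge v (fun q => u q ^ 3 - u q - g * v q)); [lra| |].
    - intros q q_in. apply flow. lra.
    - intros q q_in. assert (u s < u q).
      { apply (position_increasing g s q u v); [lra| |]; intros p p_in.
        - apply flow. lra.
        - apply moving. lra. }
      assert (1 < u q ^ 2) by nra. nra. }
  pose proof (exp_pos (- g * (r - s))). nra.
Qed.

Lemma riccati_blowup (c s : R) (z dz : R -> R) :
  0 < c -> 0 < z s -> (forall t, s <= t -> is_derive z t (dz t)) ->
  (forall t, s <= t -> c * z t ^ 2 <= dz t) -> False.
Proof.
  intros c_pos z_pos Dz growth.
  assert (z_ge : forall t, s <= t -> z s <= z t).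
  { intros t le_st. apply (derive_nonneg_le z dz s t le_st); intros r r_in; [apply Dz; lra|].
    specialize (growth r ltac:(lra)). pose proof (pow2_ge_0 (z r)). nra. }
  set (t := s + / (c * z s)).
  assert (lt_st : s < t).
  { assert (0 < / (c * z s)) by (apply Rinv_0_lt_compat; nra). unfold t. lra. }
  assert (reciprocal : - / z s - c * s <= - / z t - c * t).
  { apply (derive_nonneg_le (fun r => - / z r - c * r) (fun r => (dz r - c * z r ^ 2) / z r ^ 2));
      [lra| |]; intros r r_in; specialize (z_ge r ltac:(lra)).
    - pose proof (Dz r ltac:(lra)). derive_known; [lra|field; lra].
    - specialize (growth r ltac:(lra)). apply Rdiv_le_0_compat; [lra|apply pow_lt; lra]. }
  assert (ct : c * t = c * s + / z s) by (unfold t; field; lra).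
  specialize (z_ge t ltac:(lra)). assert (0 < / z t) by (apply Rinv_0_lt_compat; lra). lra.
Qed.

Lemma riccati_barrier_force (g c z y : R) :
  0 <= g -> c <= 1 / 2 -> g * c <= 1 -> 0 < z -> 0 < y < c * z ^ 2 ->
  0 <= (z + 1) ^ 3 - (z + 1) - g * y - 2 * c * z * y.
Proof.
  intros g_nonneg c_le gc_le z_pos y_in. assert (0 < z ^ 2) by now apply pow_lt.
  assert (g * y <= z ^ 2).
  { apply Rle_trans with (g * (c * z ^ 2)); [apply Rmult_le_compat_l; lra|].
    rewrite <- Rmult_assoc. rewrite <- (Rmult_1_l (z ^ 2)) at 2. apply Rmult_le_compat_r; lra. }
  assert (2 * c * z * y <= z * z ^ 2).
  { assert (y <= z ^ 2) by nra. rewrite (Rmult_assoc (2 * c)).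
    apply Rle_trans with (1 * (z * y)); [apply Rmult_le_compat_r; nra|nra]. }
  nra.
Qed.

(* With [z = u - 1] the cubic force is [z (z + 1) (z + 2)], which keeps [v] above [c z^2] for small
   [c]; then [z] satisfies a Riccati inequality. *)
Lemma outward_blowup (g s : R) (u v : R -> R) :
  0 <= g -> (forall t, s <= t -> duffing_at g u v t) -> 1 <= u s -> 0 < v s -> False.
Proof.
  intros g_nonneg flow u_ge v_pos.
  assert (v_pos' : forall t, s <= t -> 0 < v t).
  { intros t le_st. apply (outward_invariant g s t u v le_st); try assumption.
    intros r r_in. apply flow. lra. }
  assert (u_increasing : forall r t, s <= r < t -> u r < u t).
  { intros r t lt_rt. apply (position_increasing g r t u v); [lra| |]; intros q q_in.
    - apply flow. lra.
    - apply v_pos'. lra. }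
  pose proof (u_increasing s (s + 1) ltac:(lra)) as u_gt.
  specialize (v_pos' (s + 1) ltac:(lra)) as v_pos1.
  set (ratio := (u (s + 1) - 1) ^ 2 / v (s + 1)).
  assert (ratio_v : (u (s + 1) - 1) ^ 2 = ratio * v (s + 1)) by (unfold ratio; field; lra).
  assert (ratio_nonneg : 0 <= ratio) by (apply Rdiv_le_0_compat; [apply pow2_ge_0|lra]).
  set (c := / (2 + g + ratio)).
  assert (c_pos : 0 < c) by (apply Rinv_0_lt_compat; lra).
  assert (c_inv : c * (2 + g + ratio) = 1) by (unfold c; field; lra).
  apply (riccati_blowup c (s + 1) (fun t => u t - 1) v c_pos); [lra| |].
  { intros t le_st. destruct (flow t ltac:(lra)) as [Du _]. derive_known. ring. }
  intros t le_st. cut (0 <= v t - c * (u t - 1) ^ 2); [lra|].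
  apply (gronwall_nonneg (fun r => v r - c * (u r - 1) ^ 2)
    (fun r => u r ^ 3 - u r - g * v r - 2 * c * (u r - 1) * v r) 0 (s + 1) t le_st).
  - intros r r_in. destruct (flow r ltac:(lra)) as [Du Dv]. derive_known. ring.
  - rewrite ratio_v. nra.
  - intros r r_in below. rewrite Rmult_0_l.
    pose proof (u_increasing s r ltac:(lra)). specialize (v_pos' r ltac:(lra)).
    replace (u r ^ 3 - u r) with ((u r - 1 + 1) ^ 3 - (u r - 1 + 1)) by ring.
    apply riccati_barrier_force; try lra; nra.
Qed.

(* Low energy keeps the force bounded below, so [v] becomes positive. *)
Lemma Kminus_right_blowup (g s : R) (u v : R -> R) :
  0 <= g -> (forall t, s <= t -> duffing_at g u v t) -> 1 < u s ->
  energy (u s) (v s) < 1 / 4 -> False.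
Proof.
  intros g_nonneg flow u_gt low.
  set (e := energy (u s) (v s)) in *.
  assert (energy_le : forall t, s <= t -> energy (u t) (v t) <= e).
  { intros t le_st. apply (energy_nonincreasing g s t); [exact g_nonneg|exact le_st|].
    intros r r_in. apply flow. lra. }
  assert (right_side : forall t, s <= t -> 1 < u t).
  { intros t le_st. apply Rnot_le_lt. intros u_le.
    destruct (first_hit u s t 1 le_st) as [r [r_in [hit _]]]; [|lra|lra|].
    { intros r r_in. apply (duffing_at_continuous g r u v), flow. lra. }
    specialize (energy_le r ltac:(lra)).
    rewrite hit, energy_saddle in energy_le by now left. pose proof (pow2_ge_0 (v r)). lra. }
  destruct (classic (exists t, s <= t /\ 0 < v t)) as [[t [le_st v_pos]]|inward].
  { apply (outward_blowup g t u v g_nonneg); [intros; apply flow; lra| |exact v_pos].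
    now apply Rlt_le, right_side. }
  set (k := Rmin 1 (1 - 4 * e)).
  assert (k_pos : 0 < k) by (apply Rmin_glb_lt; lra).
  assert (k_le : k <= 1 /\ k <= 1 - 4 * e) by (split; [apply Rmin_l|apply Rmin_r]).
  assert (force : forall t, s <= t -> k <= u t ^ 3 - u t - g * v t).
  { intros t le_st. specialize (energy_le t le_st). specialize (right_side t le_st).
    rewrite energy_sqr in energy_le. pose proof (pow2_ge_0 (v t)).
    assert (v t <= 0) by (apply Rnot_lt_le; intros v_pos; apply inward; now exists t).
    assert (k <= (u t ^ 2 - 1) ^ 2) by lra. assert (0 < u t ^ 2 - 1) by nra.
    assert (k <= u t ^ 2 - 1) by nra. nra. }
  apply inward. set (t := s + (1 - v s) / k).
  assert (v_nonpos : v s <= 0) by (apply Rnot_lt_le; intros v_pos; apply inward; exists s; lra).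
  assert (0 < (1 - v s) / k) by (apply Rdiv_lt_0_compat; lra).
  exists t. split; [unfold t; lra|].
  assert (climb : v s - k * s <= v t - k * t).
  { apply (derive_nonneg_le (fun r => v r - k * r) (fun r => u r ^ 3 - u r - g * v r - k));
      [unfold t; lra| |]; intros r r_in.
    - destruct (flow r ltac:(lra)) as [_ Dv]. derive_known. ring.
    - specialize (force r ltac:(lra)). lra. }
  assert (kt : k * t = k * s + 1 - v s) by (unfold t; field; lra). lra.
Qed.

Lemma Kminus_left_blowup (g s : R) (u v : R -> R) :
  0 <= g -> (forall t, s <= t -> duffing_at g u v t) -> u s < -1 ->
  energy (u s) (v s) < 1 / 4 -> False.
Proof.
  intros g_nonneg flow u_lt low.
  apply (Kminus_right_blowup g s (fun t => - u t) (fun t => - v t) g_nonneg); [|lra|].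
  - intros t le_st. now apply duffing_at_opp, flow.
  - now rewrite energy_opp.
Qed.

(** * Exponential convergence *)

Lemma exp_decay_extend (f : R -> R) (t0 C c : R) :
  0 <= t0 -> (forall t, 0 <= t <= t0 -> continuous f t) ->
  (forall t, t0 <= t -> f t <= C * exp (- c * t)) ->
  exists C', 0 < C' /\ forall t, 0 <= t -> f t <= C' * exp (- c * t).
Proof.
  intros t0_nonneg f_cont tail.
  destruct (continuous_bounded (fun t => f t * exp (c * t)) 0 t0 t0_nonneg) as [M [M_pos bound]].
  { intros t t_in. apply (continuous_mult f (fun t => exp (c * t))); [now apply f_cont|].
    apply (ex_derive_continuous (fun t => exp (c * t))). auto_derive. exact I. }
  exists (M + Rabs C). split; [pose proof (Rabs_pos C); lra|]. intros t t_nonneg.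
  pose proof (exp_pos (- c * t)). pose proof (Rle_abs C).
  destruct (Rle_dec t0 t) as [late|early].
  - eapply Rle_trans; [now apply tail|]. apply Rmult_le_compat_r; lra.
  - specialize (bound t ltac:(lra)). simpl in bound. apply Rabs_le_between in bound.
    replace (f t) with (f t * exp (c * t) * exp (- c * t)).
    + apply Rmult_le_compat_r; [lra|]. pose proof (Rabs_pos C). lra.
    + rewrite Rmult_assoc, <- exp_plus. replace (c * t + - c * t) with 0 by ring.
      rewrite exp_0. ring.
Qed.

Lemma exp_decay_lim (w : R -> R) (l C c : R) :
  0 < c -> (forall t, 0 <= t -> Rabs (w t - l) <= C * exp (- c * t)) -> is_lim w p_infty l.
Proof.
  intros c_pos decay.
  assert (vanish : is_lim (fun t => C * exp (- c * t)) p_infty 0).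
  { replace (Finite 0) with (Rbar_mult C 0) by (simpl; f_equal; ring).
    apply is_lim_scal_l, (is_lim_comp exp (fun t => - c * t) p_infty 0 m_infty is_lim_exp_m).
    - replace m_infty with (Rbar_mult (- c) p_infty).
      + apply (is_lim_scal_l (fun t => t)), is_lim_id.
      + simpl. destruct Rle_dec; [exfalso; lra|reflexivity].
    - now exists 0. }
  apply (is_lim_le_le_loc (fun t => l - C * exp (- c * t)) (fun t => l + C * exp (- c * t))).
  - exists 0. intros t t_pos. specialize (decay t ltac:(lra)).
    apply Rabs_le_between in decay. lra.
  - replace (Finite l) with (Finite (l - 0)) by (f_equal; ring).
    apply is_lim_minus'; [apply is_lim_const|exact vanish].
  - replace (Finite l) with (Finite (l + 0)) by (f_equal; ring).
    apply is_lim_plus'; [apply is_lim_const|exact vanish].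
Qed.

Lemma exponential_convergence (g a b t0 C c : R) (u v : R -> R) :
  (forall t, 0 <= t -> duffing_at g u v t) -> 0 <= t0 -> 0 < c ->
  (forall t, t0 <= t -> (u t - a) ^ 2 + (v t - b) ^ 2 <= C * exp (- c * t)) ->
  converges_exponentially a b p_infty u v.
Proof.
  intros flow t0_nonneg c_pos tail.
  set (sq := fun t => (u t - a) ^ 2 + (v t - b) ^ 2) in tail.
  destruct (exp_decay_extend sq t0 C c t0_nonneg) as [C' [C'_pos sq_decay]]; [|exact tail|].
  { intros t t_in. destruct (flow t ltac:(lra)) as [Du Dv].
    apply (ex_derive_continuous sq). unfold sq. auto_derive.
    repeat split; eexists; eassumption. }
  assert (decay : forall t, 0 <= t ->
    sqrt ((u t - a) ^ 2 + (v t - b) ^ 2) <= sqrt C' * exp (- (c / 2) * t)).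
  { intros t t_nonneg. rewrite <- (sqrt_pow2 (exp (- (c / 2) * t))) by apply Rlt_le, exp_pos.
    rewrite <- sqrt_mult_alt by lra. apply sqrt_le_1_alt.
    replace (exp (- (c / 2) * t) ^ 2) with (exp (- c * t)); [now apply sq_decay|].
    simpl. rewrite Rmult_1_r, <- exp_plus. f_equal. field. }
  assert (parts : forall t, 0 <= t -> Rabs (u t - a) <= sqrt C' * exp (- (c / 2) * t) /\
    Rabs (v t - b) <= sqrt C' * exp (- (c / 2) * t)).
  { intros t t_nonneg. specialize (decay t t_nonneg).
    destruct (sqrt_plus_sqr (u t - a) (v t - b)) as [max_le _].
    pose proof (Rmax_l (Rabs (u t - a)) (Rabs (v t - b))).
    pose proof (Rmax_r (Rabs (u t - a)) (Rabs (v t - b))). lra. }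
  split; [reflexivity|]. split; [|split].
  - apply (exp_decay_lim u a (sqrt C') (c / 2)); [lra|]. intros t t_nonneg. now apply parts.
  - apply (exp_decay_lim v b (sqrt C') (c / 2)); [lra|]. intros t t_nonneg. now apply parts.
  - exists (sqrt C'), (c / 2). split; [now apply sqrt_lt_R0|]. split; [lra|].
    intros t t_nonneg. apply decay. lra.
Qed.

Lemma converges_exponentially_ext (a b : R) (T : Rbar) (u v u' v' : R -> R) :
  (forall t, 0 <= t -> u' t = u t /\ v' t = v t) ->
  converges_exponentially a b T u' v' -> converges_exponentially a b T u v.
Proof.
  intros same [global [lim_u [lim_v [C [c [C_pos [c_pos decay]]]]]]].
  split; [exact global|]. split; [|split].
  - apply is_lim_ext_loc with u'; [|exact lim_u]. exists 0. intros t t_pos. apply same. lra.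
  - apply is_lim_ext_loc with v'; [|exact lim_v]. exists 0. intros t t_pos. apply same. lra.
  - exists C, c. split; [exact C_pos|]. split; [exact c_pos|]. intros t t_nonneg.
    destruct (same t ltac:(lra)) as [<- <-]. now apply decay.
Qed.

Lemma well_invariant (g s t : R) (u v : R -> R) :
  0 <= g -> s <= t -> (forall r, s <= r <= t -> duffing_at g u v r) -> Rabs (u s) < 1 ->
  energy (u s) (v s) < 1 / 4 -> Rabs (u t) < 1.
Proof.
  intros g_nonneg le_st flow inside low. apply Rnot_le_lt. intros outside.
  destruct (intermediate_value (fun r => Rabs (u r)) s t 1 le_st) as [r [r_in hit]]; [|lra|].
  { intros r r_in. apply (continuous_comp u Rabs); [|apply continuous_Rabs].
    now apply (duffing_at_continuous g r u v), flow. }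
  assert (energy (u r) (v r) <= energy (u s) (v s)).
  { apply (energy_nonincreasing g); [exact g_nonneg|lra|]. intros q q_in. apply flow. lra. }
  assert (saddle (u r)) by (apply saddle_sqr; rewrite <- pow2_abs, hit; ring).
  pose proof (pow2_ge_0 (v r)). rewrite energy_saddle in * by assumption. lra.
Qed.

Lemma well_depth (g s t : R) (u v : R -> R) :
  0 <= g -> s <= t -> (forall r, s <= r <= t -> duffing_at g u v r) -> Rabs (u s) < 1 ->
  energy (u s) (v s) < 1 / 4 -> 1 - 4 * energy (u s) (v s) <= 1 - u t ^ 2.
Proof.
  intros g_nonneg le_st flow inside low.
  pose proof (well_invariant g s t u v g_nonneg le_st flow inside low).
  pose proof (energy_nonincreasing g s t u v g_nonneg le_st flow) as low_t.
  rewrite (energy_sqr (u t)) in low_t. rewrite <- (pow2_abs (u t)) in *.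
  pose proof (Rabs_pos (u t)). pose proof (pow2_ge_0 (v t)).
  assert (0 < 1 - Rabs (u t) ^ 2 <= 1) by nra. nra.
Qed.

Lemma lyapunov_equivalence (p x y : R) :
  0 <= p <= 1 / 4 -> x ^ 2 <= 1 ->
  (x ^ 2 + y ^ 2) / 8 <= energy x y + p * x * y <= x ^ 2 + y ^ 2.
Proof.
  intros p_in x_le. unfold energy.
  pose proof (pow2_ge_0 (x - y)). pose proof (pow2_ge_0 (x + y)).
  pose proof (pow2_ge_0 x). pose proof (pow2_ge_0 y).
  assert (- (x ^ 2 + y ^ 2) / 8 <= p * x * y <= (x ^ 2 + y ^ 2) / 8).
  { assert (- (x ^ 2 + y ^ 2) / 2 <= x * y <= (x ^ 2 + y ^ 2) / 2) by lra.
    rewrite Rmult_assoc. nra. }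
  assert (0 <= x ^ 4 <= x ^ 2) by nra. lra.
Qed.

Lemma lyapunov_dissipation (g k p x y : R) :
  0 < k -> 0 <= p -> p * (1 + g ^ 2 / (2 * k)) <= g / 2 -> k <= 1 - x ^ 2 ->
  - g * y ^ 2 + p * (y ^ 2 + x * (x ^ 3 - x - g * y))
    <= - (g / 2 * y ^ 2 + p * k / 2 * x ^ 2).
Proof.
  intros k_pos p_nonneg p_le x_in. pose proof (pow2_ge_0 x). pose proof (pow2_ge_0 y).
  assert (young : - (g * (x * y)) <= k / 2 * x ^ 2 + g ^ 2 / (2 * k) * y ^ 2).
  { assert (0 <= (k * x + g * y) ^ 2 / (2 * k)) by (apply Rdiv_le_0_compat; [apply pow2_ge_0|lra]).
    replace (k / 2 * x ^ 2 + g ^ 2 / (2 * k) * y ^ 2)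
      with ((k * x + g * y) ^ 2 / (2 * k) - g * (x * y)) by (field; lra). lra. }
  assert (restoring : k * x ^ 2 <= x ^ 2 * (1 - x ^ 2)) by nra.
  assert (p * (y ^ 2 + x * (x ^ 3 - x - g * y))
    <= p * ((1 + g ^ 2 / (2 * k)) * y ^ 2 - k / 2 * x ^ 2)) by (apply Rmult_le_compat_l; lra).
  assert (p * (1 + g ^ 2 / (2 * k)) * y ^ 2 <= g / 2 * y ^ 2) by now apply Rmult_le_compat_r.
  lra.
Qed.

Lemma well_convergence (g s : R) (u v : R -> R) :
  0 < g -> 0 <= s -> (forall t, 0 <= t -> duffing_at g u v t) -> Rabs (u s) < 1 ->
  energy (u s) (v s) < 1 / 4 -> converges_exponentially 0 0 p_infty u v.
Proof.
  intros g_pos s_nonneg flow inside low.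
  set (k := 1 - 4 * energy (u s) (v s)). assert (k_pos : 0 < k) by (unfold k; lra).
  assert (depth : forall t, s <= t -> k <= 1 - u t ^ 2).
  { intros t le_st. apply (well_depth g s t u v); try assumption; [lra|].
    intros r r_in. apply flow. lra. }
  set (q := 1 + g ^ 2 / (2 * k)).
  assert (q_ge : 1 <= q).
  { assert (0 <= g ^ 2 / (2 * k)) by (apply Rdiv_le_0_compat; [apply pow2_ge_0|lra]).
    unfold q. lra. }
  set (p := Rmin (1 / 4) (g / (2 * q))).
  assert (p_pos : 0 < p) by (apply Rmin_glb_lt; [lra|apply Rdiv_lt_0_compat; lra]).
  assert (p_small : p <= 1 / 4) by apply Rmin_l.
  assert (pq_le : p * q <= g / 2).
  { replace (g / 2) with (g / (2 * q) * q) by (field; lra).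
    apply Rmult_le_compat_r; [lra|apply Rmin_r]. }
  set (c := Rmin (g / 2) (p * k / 2)).
  assert (c_pos : 0 < c) by (apply Rmin_glb_lt; nra).
  assert (c_le : c <= g / 2 /\ c <= p * k / 2) by (split; [apply Rmin_l|apply Rmin_r]).
  set (L := fun t => energy (u t) (v t) + p * u t * v t).
  set (dL := fun t => - g * v t ^ 2 + p * (v t ^ 2 + u t * (u t ^ 3 - u t - g * v t))).
  assert (L_bounds : forall t, s <= t -> (u t ^ 2 + v t ^ 2) / 8 <= L t <= u t ^ 2 + v t ^ 2).
  { intros t le_st. apply lyapunov_equivalence; [lra|]. specialize (depth t le_st). lra. }
  assert (L_decay : forall t, s <= t -> L t <= L s * exp (- c * (t - s))).
  { intros t le_st. apply (gronwall_le L dL); [exact le_st| |]; intros r r_in.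
    - destruct (flow r ltac:(lra)) as [Du Dv]. unfold L, dL, energy. derive_known. field.
    - pose proof (lyapunov_dissipation g k p (u r) (v r) k_pos ltac:(lra) pq_le
        (depth r ltac:(lra))) as dissipation. fold (dL r) in dissipation.
      specialize (L_bounds r ltac:(lra)).
      pose proof (pow2_ge_0 (u r)). pose proof (pow2_ge_0 (v r)). nra. }
  apply (exponential_convergence g 0 0 s (8 * L s * exp (c * s)) c u v); try assumption.
  intros t le_st. rewrite !Rminus_0_r, Rmult_assoc, <- exp_plus.
  replace (c * s + - c * t) with (- c * (t - s)) by ring.
  specialize (L_bounds t le_st). specialize (L_decay t le_st). lra.
Qed.

(* Since [v] decreases, [v t <= u t - u (t - 1) <= a - u (t - 1)]. *)
Lemma saddle_convergence (g a t0 : R) (u v : R -> R) :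
  0 <= g -> 0 <= t0 -> (forall t, 0 <= t -> duffing_at g u v t) ->
  (forall t, t0 <= t -> 0 < v t /\ u t < a /\ u t ^ 3 - u t <= 0 /\ a - u t <= 2 * v t) ->
  converges_exponentially a 0 p_infty u v.
Proof.
  intros g_nonneg t0_nonneg flow approach.
  set (W := (a - u t0) * exp (1 / 2 * t0)).
  assert (gap_decay : forall t, t0 <= t -> a - u t <= W * exp (- (1 / 2) * t)).
  { intros t le_t. unfold W. rewrite Rmult_assoc, <- exp_plus.
    replace (1 / 2 * t0 + - (1 / 2) * t) with (- (1 / 2) * (t - t0)) by ring.
    apply (gronwall_le (fun r => a - u r) (fun r => - v r)); [exact le_t| |]; intros r r_in.
    - destruct (flow r ltac:(lra)) as [Du _]. derive_known. ring.
    - destruct (approach r ltac:(lra)) as [_ [_ [_ v_ge]]]. lra. }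
  assert (v_decay : forall t, t0 + 1 <= t -> v t <= a - u (t - 1)).
  { intros t le_t.
    destruct (mean_value u v (t - 1) t) as [r [r_in slope]]; [lra| |].
    { intros r r_in. apply flow. lra. }
    assert (- v r <= - v t).
    { apply (derive_nonneg_le (fun q => - v q) (fun q => - (u q ^ 3 - u q - g * v q)));
        [lra| |]; intros q q_in.
      - destruct (flow q ltac:(lra)) as [_ Dv]. derive_known. ring.
      - destruct (approach q ltac:(lra)) as [v_pos [_ [force _]]]. nra. }
    destruct (approach t ltac:(lra)) as [_ [u_lt _]]. lra. }
  assert (sqr_exp : forall w t, 0 <= w <= W * exp (- (1 / 2) * t) -> w ^ 2 <= W ^ 2 * exp (- t)).
  { intros w t w_in. replace (exp (- t)) with (exp (- (1 / 2) * t) ^ 2).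
    - rewrite <- Rpow_mult_distr. now apply pow_incr.
    - simpl. rewrite Rmult_1_r, <- exp_plus. f_equal. field. }
  apply (exponential_convergence g a 0 (t0 + 1) (W ^ 2 * (1 + exp 1)) 1 u v flow); [lra|lra|].
  intros t le_t. rewrite Rminus_0_r.
  destruct (approach t ltac:(lra)) as [v_pos [u_lt _]].
  pose proof (gap_decay t ltac:(lra)). pose proof (gap_decay (t - 1) ltac:(lra)).
  pose proof (v_decay t le_t).
  pose proof (sqr_exp (a - u t) t ltac:(lra)). pose proof (sqr_exp (v t) (t - 1) ltac:(lra)).
  replace (- (1) * t) with (- t) by ring.
  replace (exp (- (t - 1))) with (exp 1 * exp (- t)) in * by (rewrite <- exp_plus; f_equal; ring).
  lra.
Qed.

(** * Orbits of rightward motion *)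

Lemma phase_graph (u v dv : R -> R) (a b : R) :
  a <= b -> (forall t, a <= t <= b -> is_derive u t (v t)) ->
  (forall t, a <= t <= b -> is_derive v t (dv t)) -> (forall t, a <= t <= b -> 0 < v t) ->
  exists V : R -> R, forall t, a <= t <= b -> V (u t) = v t /\ is_derive V (u t) (dv t / v t).
Proof.
  intros le_ab Du Dv v_pos.
  destruct (continuous_pos_min v a b le_ab) as [m [m_pos v_ge]]; [|exact v_pos|].
  { intros t t_in. eapply is_derive_continuous, Dv, t_in. }
  set (U := extension_C1 u v a b). set (W := extension_C1 v dv a b).
  assert (DU : forall t, is_derive U t (extension_C0 v a b t)).
  { now apply (extension_C1_is_derive (V := R_NormedModule)); [|intros; apply Du]. }
  assert (DW : forall t, is_derive W t (extension_C0 dv a b t)).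
  { now apply (extension_C1_is_derive (V := R_NormedModule)); [|intros; apply Dv]. }
  destruct (expanding_inverse U (extension_C0 v a b) m m_pos DU) as [time [timeU [_ Dtime]]].
  { intros t. unfold extension_C0. repeat destruct Rbar_le_dec; apply v_ge; simpl in *; lra. }
  exists (fun x => W (time x)). intros t t_in.
  assert (U_t : U t = u t) by now apply extension_C1_ext.
  assert (time_u : time (u t) = t) by now rewrite <- U_t.
  specialize (Dtime (u t)). specialize (DW (time (u t))).
  rewrite time_u, extension_C0_ext in Dtime, DW by (simpl; lra).
  rewrite time_u. split; [now apply extension_C1_ext|].
  replace (dv t / v t) with (scal (/ v t) (dv t)) by (unfold scal; simpl; unfold mult; simpl; field;
    specialize (v_pos t t_in); lra).
  apply (is_derive_comp W time (u t) (dv t) (/ v t)); [now rewrite time_u|exact Dtime].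
Qed.

Section Orbits.

Variables u0 u1 : R.
Hypothesis u1_pos : 0 < u1.

(* While [v > 0] the velocity is a function of the position, [dv/du = (u^3 - u) / v - g]. *)
Definition orbit (g b : R) (V : R -> R) : Prop :=
  V u0 = u1 /\ forall x, u0 <= x <= b -> 0 < V x /\ is_derive V x ((x ^ 3 - x) / V x - g).

Definition reaches (g x y : R) : Prop := u0 <= x /\ exists V, orbit g x V /\ V x = y.

Definition crosses (g x : R) : Prop := exists y, reaches g x y.

Definition stalls (g x : R) : Prop :=
  (forall z, crosses g z -> z < x) /\
  forall eps, 0 < eps -> exists z y, reaches g z y /\ x - eps < z /\ y < eps.

Lemma orbit_le_bound (g x b : R) (V : R -> R) : x <= b -> orbit g b V -> orbit g x V.
Proof. intros le_xb [start ode]. split; [exact start|]. intros z z_in. apply ode. lra. Qed.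

Lemma orbit_reaches (g x b : R) (V : R -> R) :
  orbit g b V -> u0 <= x <= b -> reaches g x (V x).
Proof.
  intros orb x_in. split; [lra|]. exists V. split; [|reflexivity].
  now apply orbit_le_bound with b.
Qed.

Lemma orbit_continuous (g b x : R) (V : R -> R) :
  orbit g b V -> u0 <= x <= b -> continuous V x.
Proof. intros [_ ode] x_in. eapply is_derive_continuous, ode, x_in. Qed.

Lemma orbit_velocity_min (g b : R) (V : R -> R) :
  orbit g b V -> u0 <= b -> exists m, 0 < m /\ forall x, u0 <= x <= b -> m <= V x.
Proof.
  intros orb le_b. apply continuous_pos_min; [exact le_b| |].
  - intros x x_in. now apply (orbit_continuous g b).
  - intros x x_in. now apply orb.
Qed.

Lemma crosses_le (g x z : R) : crosses g x -> u0 <= z <= x -> crosses g z.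
Proof.
  intros [y [_ [V [orb _]]]] z_in. exists (V z). now apply orbit_reaches with x.
Qed.

Lemma reaches_velocity_pos (g x y : R) : reaches g x y -> 0 < y.
Proof. intros [le_x [V [orb <-]]]. apply orb. lra. Qed.

Section Comparison.

Variables (g g' b : R) (V Q : R -> R).
Hypothesis orbit_V : orbit g b V.
Hypothesis orbit_Q : orbit g' b Q.

Definition gap_rate (x : R) : R := (x - x ^ 3) / (V x * Q x).

Lemma is_derive_gap (x : R) :
  u0 <= x <= b ->
  is_derive (fun z => V z - Q z) x (g' - g + gap_rate x * (V x - Q x)).
Proof.
  intros x_in. destruct (proj2 orbit_V x x_in) as [V_pos DV].
  destruct (proj2 orbit_Q x x_in) as [Q_pos DQ].
  unfold gap_rate. derive_known. field. lra.
Qed.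

Lemma gap_rate_bounded :
  u0 <= b -> exists K, 0 < K /\ forall x, u0 <= x <= b -> - K <= gap_rate x <= K.
Proof.
  intros le_b. destruct (continuous_bounded gap_rate u0 b le_b) as [K [K_pos bound]].
  - intros x x_in. destruct (proj2 orbit_V x x_in) as [V_pos DV].
    destruct (proj2 orbit_Q x x_in) as [Q_pos DQ].
    apply (ex_derive_continuous gap_rate). unfold gap_rate. auto_derive.
    repeat split; try (eexists; eassumption). nra.
  - exists K. split; [exact K_pos|]. intros x x_in. now apply Rabs_le_between, bound.
Qed.

Lemma orbit_le (x : R) : g <= g' -> u0 <= x <= b -> Q x <= V x.
Proof.
  intros le_g x_in. destruct (gap_rate_bounded ltac:(lra)) as [K [K_pos bound]].
  cut (0 <= V x - Q x); [lra|].
  apply (gronwall_nonneg (fun z => V z - Q z) (fun z => g' - g + gap_rate z * (V z - Q z)) K u0 x).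
  - lra.
  - intros z z_in. apply is_derive_gap. lra.
  - rewrite (proj1 orbit_V), (proj1 orbit_Q). lra.
  - intros z z_in neg. specialize (bound z ltac:(lra)). nra.
Qed.

Lemma orbit_lt : g < g' -> u0 < b -> Q b < V b.
Proof.
  intros lt_g lt_b. destruct (gap_rate_bounded ltac:(lra)) as [K [K_pos bound]].
  cut ((V u0 - Q u0) * exp (- K * (b - u0)) < V b - Q b).
  { rewrite (proj1 orbit_V), (proj1 orbit_Q), Rminus_diag, Rmult_0_l. lra. }
  apply (gronwall_gt (fun z => V z - Q z) (fun z => g' - g + gap_rate z * (V z - Q z))).
  - intros z z_in. now apply is_derive_gap.
  - exact lt_b.
  - intros z z_in. specialize (bound z ltac:(lra)).
    pose proof (orbit_le z ltac:(lra) ltac:(lra)). nra.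
Qed.

Lemma orbit_gap_nondecreasing (a : R) :
  g <= g' -> u0 <= a <= b -> (forall x, a <= x <= b -> 0 <= x - x ^ 3) ->
  V a - Q a <= V b - Q b.
Proof.
  intros le_g a_in restoring.
  apply (derive_nonneg_le (fun z => V z - Q z) (fun z => g' - g + gap_rate z * (V z - Q z)));
    [lra| |]; intros z z_in.
  - apply is_derive_gap. lra.
  - pose proof (orbit_le z le_g ltac:(lra)). specialize (restoring z ltac:(lra)).
    assert (0 <= gap_rate z); [|nra].
    apply Rdiv_le_0_compat; [exact restoring|].
    apply Rmult_lt_0_compat; [apply orbit_V|apply orbit_Q]; lra.
Qed.

Lemma orbit_gap_le (m P : R) :
  g <= g' -> u0 <= b -> 0 < m -> (forall x, u0 <= x <= b -> m <= V x /\ m <= Q x) ->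
  (forall x, u0 <= x <= b -> Rabs (x - x ^ 3) <= P) ->
  V b - Q b <= (g' - g) * exp ((P / m ^ 2 + 1) * (b - u0)).
Proof.
  intros le_g le_b m_pos fast force.
  assert (grow : V b - Q b + (g' - g)
    <= (V u0 - Q u0 + (g' - g)) * exp ((P / m ^ 2 + 1) * (b - u0))).
  { apply (gronwall_le (fun z => V z - Q z + (g' - g))
      (fun z => g' - g + gap_rate z * (V z - Q z))); [exact le_b| |]; intros z z_in.
    - replace (g' - g + gap_rate z * (V z - Q z))
        with (g' - g + gap_rate z * (V z - Q z) + 0) by ring.
      apply (is_derive_plus (fun z => V z - Q z) (fun _ => g' - g)); [now apply is_derive_gap|].
      apply (is_derive_const (g' - g)).
    - pose proof (orbit_le z le_g ltac:(lra)). specialize (force z ltac:(lra)).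
      destruct (fast z ltac:(lra)) as [m_le_V m_le_Q]. pose proof (Rabs_pos (z - z ^ 3)).
      assert (0 < m ^ 2) by now apply pow_lt.
      assert (0 <= P / m ^ 2) by (apply Rdiv_le_0_compat; lra).
      assert (gap_rate z <= P / m ^ 2).
      { pose proof (Rle_abs (z - z ^ 3)). unfold gap_rate, Rdiv.
        assert (0 < / (V z * Q z)) by (apply Rinv_0_lt_compat; nra).
        apply Rle_trans with (P * / (V z * Q z)); [apply Rmult_le_compat_r; lra|].
        apply Rmult_le_compat_l; [lra|]. apply Rinv_le_contravar; nra. }
      nra. }
  rewrite (proj1 orbit_V), (proj1 orbit_Q), Rminus_diag, Rplus_0_l in grow. lra.
Qed.

End Comparison.

Lemma reaches_le (g g' x y y' : R) : g <= g' -> reaches g x y -> reaches g' x y' -> y' <= y.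
Proof.
  intros le_g [le_x [V [orbit_V <-]]] [_ [Q [orbit_Q <-]]].
  apply (orbit_le g g' x); [assumption..|lra].
Qed.

Lemma reaches_lt (g g' x y y' : R) :
  g < g' -> u0 < x -> reaches g x y -> reaches g' x y' -> y' < y.
Proof.
  intros lt_g lt_x [_ [V [orbit_V <-]]] [_ [Q [orbit_Q <-]]].
  now apply (orbit_lt g g' x).
Qed.

Lemma reaches_unique (g x y y' : R) : reaches g x y -> reaches g x y' -> y = y'.
Proof. intros here here'. apply Rle_antisym; apply (reaches_le g g x); auto; lra. Qed.

Lemma reaches_gap_nondecreasing (g g' a b va vb qa qb : R) :
  g <= g' -> a <= b -> (forall x, a <= x <= b -> 0 <= x - x ^ 3) ->
  reaches g a va -> reaches g' a qa -> reaches g b vb -> reaches g' b qb ->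
  va - qa <= vb - qb.
Proof.
  intros le_g le_ab restoring reach_va reach_qa [_ [V [orbit_V <-]]] [_ [Q [orbit_Q <-]]].
  assert (a_in : u0 <= a <= b) by (split; [apply reach_va|exact le_ab]).
  rewrite (reaches_unique g a va (V a) reach_va) by now apply orbit_reaches with b.
  rewrite (reaches_unique g' a qa (Q a) reach_qa) by now apply orbit_reaches with b.
  now apply (orbit_gap_nondecreasing g g').
Qed.

Lemma stalls_gt_start (g x : R) : stalls g x -> u0 < x.
Proof.
  intros [bound approach]. destruct (approach 1 ltac:(lra)) as [z [y [[le_z orb] _]]].
  apply Rle_lt_trans with z; [exact le_z|]. apply bound. now exists y.
Qed.

Lemma stalls_crosses (g x z : R) : stalls g x -> u0 <= z < x -> crosses g z.
Proof.
  intros [_ approach] z_in. destruct (approach (x - z) ltac:(lra)) as [w [y [reach [lt_w _]]]].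
  apply crosses_le with w; [now exists y|lra].
Qed.

Lemma stalls_crosses_lt (g g' x z : R) : g <= g' -> stalls g x -> crosses g' z -> z < x.
Proof.
  intros le_g stall cross. apply Rnot_le_lt. intros le_xz.
  pose proof (stalls_gt_start g x stall) as lt_x.
  destruct (crosses_le g' z x cross ltac:(lra)) as [_ [_ [Q [orbit_Q _]]]].
  destruct (orbit_velocity_min g' x Q orbit_Q ltac:(lra)) as [m [m_pos Q_ge]].
  destruct stall as [bound approach]. destruct (approach m m_pos) as [w [y [reach [_ slow]]]].
  assert (lt_wx : w < x) by (apply bound; now exists y).
  assert (w_in : u0 <= w <= x) by (split; [apply reach|lra]).
  pose proof (reaches_le g g' w y (Q w) le_g reach) as le_y.
  specialize (le_y ltac:(now apply orbit_reaches with x)). specialize (Q_ge w w_in). lra.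
Qed.

Lemma stalls_unique (g x x' : R) : stalls g x -> stalls g x' -> x = x'.
Proof.
  assert (le : forall z z', stalls g z -> stalls g z' -> z' <= z).
  { intros z z' stall stall'. apply Rnot_lt_le. intros lt_z.
    pose proof (stalls_gt_start g z stall).
    pose proof (stalls_crosses_lt g g z z (Rle_refl g) stall) as loop.
    specialize (loop ltac:(apply (stalls_crosses g z'); [exact stall'|lra])). lra. }
  intros stall stall'. apply Rle_antisym; now apply le.
Qed.

(** * The flow along its orbit *)

Definition moving (T : Rbar) (v : R -> R) (s : R) : Prop :=
  forward_interval T s /\ forall t, 0 <= t <= s -> 0 < v t.

Definition halts (T : Rbar) (u v : R -> R) (x : R) : Prop :=
  (forall s, moving T v s -> u s < x) /\
  forall eps, 0 < eps -> exists s, moving T v s /\ x - eps < u s /\ v s < eps.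

Section Flow.

Variables (g : R) (T : Rbar) (u v : R -> R).
Hypothesis flow : complete_flow g u0 u1 T u v.

Lemma flow_duffing_upto (s t : R) : forward_interval T s -> 0 <= t <= s -> duffing_at g u v t.
Proof.
  intros s_in t_in. apply (flow_duffing flow). now apply forward_interval_le with s.
Qed.

Lemma moving_le (s t : R) : moving T v s -> 0 <= t <= s -> moving T v t.
Proof.
  intros [s_in v_pos] t_in. split; [now apply forward_interval_le with s|].
  intros r r_in. apply v_pos. lra.
Qed.

Lemma moving_start : moving T v 0.
Proof.
  split; [split; [lra|apply (flow_time_pos flow)]|].
  intros t t_in. replace t with 0 by lra. now rewrite (flow_velocity0 flow).
Qed.

Lemma moving_increasing (s t : R) : moving T v t -> 0 <= s < t -> u s < u t.
Proof.
  intros [t_in v_pos] s_in. apply (position_increasing g s t u v); [lra| |]; intros r r_in.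
  - apply (flow_duffing_upto t); [exact t_in|lra].
  - apply v_pos. lra.
Qed.

Lemma moving_position (s y : R) :
  moving T v s -> u0 <= y <= u s -> exists r, moving T v r /\ u r = y.
Proof.
  intros mov y_in. destruct (intermediate_value u 0 s y) as [r [r_in hit]].
  - apply mov.
  - intros t t_in. apply (duffing_at_continuous g t u v), (flow_duffing_upto s); [apply mov|lra].
  - now rewrite (flow_position0 flow).
  - exists r. split; [now apply moving_le with s|exact hit].
Qed.

Lemma moving_reaches (s : R) : moving T v s -> reaches g (u s) (v s).
Proof.
  intros mov. assert (mov' := mov). destruct mov' as [s_in v_pos].
  assert (s_nonneg : 0 <= s) by apply s_in.
  assert (ode : forall t, 0 <= t <= s -> duffing_at g u v t)
    by (intros; now apply flow_duffing_upto with s).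
  destruct (phase_graph u v (fun t => u t ^ 3 - u t - g * v t) 0 s s_nonneg) as [V graph];
    [intros; now apply ode|intros; now apply ode|exact v_pos|].
  destruct (graph 0 ltac:(lra)) as [start _].
  rewrite (flow_position0 flow), (flow_velocity0 flow) in start.
  assert (u0_le : u0 <= u s).
  { rewrite <- (flow_position0 flow). destruct (Req_dec s 0) as [->|ne]; [lra|].
    apply Rlt_le, moving_increasing; [exact mov|lra]. }
  split; [exact u0_le|]. exists V. split; [|apply graph; lra]. split; [exact start|].
  intros x x_in. destruct (intermediate_value u 0 s x s_nonneg) as [t [t_in <-]].
  - intros t t_in. now apply (duffing_at_continuous g t u v), ode.
  - now rewrite (flow_position0 flow).
  - destruct (graph t t_in) as [-> DV]. specialize (v_pos t t_in). split; [exact v_pos|].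
    replace ((u t ^ 3 - u t) / v t - g) with ((u t ^ 3 - u t - g * v t) / v t) by (field; lra).
    exact DV.
Qed.

Lemma halts_stalls (x : R) : halts T u v x -> stalls g x.
Proof.
  intros [bound approach]. split.
  - intros z cross. apply Rnot_le_lt. intros le_xz.
    pose proof (bound 0 moving_start) as lt_x. rewrite (flow_position0 flow) in lt_x.
    destruct (crosses_le g z x cross ltac:(lra)) as [_ [_ [V [orbit_V _]]]].
    destruct (orbit_velocity_min g x V orbit_V ltac:(lra)) as [m [m_pos V_ge]].
    destruct (approach m m_pos) as [s [mov [_ slow]]].
    pose proof (moving_reaches s mov) as reach. specialize (bound s mov).
    assert (x_in : u0 <= u s <= x) by (split; [apply reach|lra]).
    pose proof (orbit_reaches g (u s) x V orbit_V x_in) as reach'.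
    pose proof (reaches_unique g (u s) _ _ reach reach'). specialize (V_ge (u s) x_in). lra.
  - intros eps eps_pos. destruct (approach eps eps_pos) as [s [mov [near slow]]].
    exists (u s), (v s). split; [now apply moving_reaches|]. now split.
Qed.

Lemma halts_at_rest (s : R) :
  forward_interval T s -> (forall t, 0 <= t < s -> 0 < v t) -> v s = 0 -> halts T u v (u s).
Proof.
  intros s_in v_pos rest.
  assert (s_pos : 0 < s).
  { destruct (proj1 s_in) as [|s0]; [assumption|subst s].
    rewrite (flow_velocity0 flow) in rest. lra. }
  split.
  - intros t [t_in v_pos']. assert (lt_ts : t < s).
    { apply Rnot_le_lt. intros le_st. specialize (v_pos' s ltac:(lra)). lra. }
    apply (position_increasing g t s u v lt_ts); intros r r_in.
    + apply (flow_duffing_upto s); [exact s_in|]. assert (0 <= t) by apply t_in. lra.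
    + apply v_pos. assert (0 <= t) by apply t_in. lra.
  - intros eps eps_pos.
    destruct (duffing_at_continuous g s u v) as [cont_u cont_v].
    { apply (flow_duffing_upto s); [exact s_in|lra]. }
    destruct (continuous_eps u s eps cont_u eps_pos) as [du [du_pos near_u]].
    destruct (continuous_eps v s eps cont_v eps_pos) as [dv [dv_pos near_v]].
    set (h := Rmin s (Rmin du dv) / 2).
    assert (0 < Rmin s (Rmin du dv)) by (repeat apply Rmin_glb_lt; lra).
    pose proof (Rmin_l s (Rmin du dv)). pose proof (Rmin_r s (Rmin du dv)).
    pose proof (Rmin_l du dv). pose proof (Rmin_r du dv).
    specialize (near_u (s - h) ltac:(apply Rabs_def1; unfold h; lra)).
    specialize (near_v (s - h) ltac:(apply Rabs_def1; unfold h; lra)).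
    apply Rabs_def2 in near_u. apply Rabs_def2 in near_v.
    exists (s - h). split; [split|lra].
    + apply forward_interval_le with s; [unfold h; lra|exact s_in].
    + intros t t_in. apply v_pos. unfold h in *. lra.
Qed.

Lemma stops_halts (t : R) :
  forward_interval T t -> v t <= 0 ->
  exists s, forward_interval T s /\ v s = 0 /\ halts T u v (u s).
Proof.
  intros t_in v_nonpos.
  destruct (first_hit v 0 t 0) as [s [s_in [rest before]]]; [apply t_in| | |exact v_nonpos|].
  - intros r r_in. apply (duffing_at_continuous g r u v). now apply (flow_duffing_upto t).
  - now rewrite (flow_velocity0 flow).
  - assert (s_in' : forward_interval T s) by (apply forward_interval_le with t; [lra|exact t_in]).
    exists s. split; [exact s_in'|]. split; [exact rest|].
    apply halts_at_rest; [exact s_in'|intros; apply before; lra|exact rest].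
Qed.

Lemma moving_bounded_global (b : R) :
  0 <= g -> (forall t, forward_interval T t -> 0 < v t) ->
  (forall t, moving T v t -> u t < b) -> T = p_infty /\ forall t, 0 <= t -> moving T v t.
Proof.
  intros g_nonneg v_pos below.
  assert (all_moving : forall t, forward_interval T t -> moving T v t).
  { intros t t_in. split; [exact t_in|]. intros r r_in. apply v_pos.
    now apply forward_interval_le with t. }
  assert (global : T = p_infty).
  { apply (bounded_position_global g u0 u1 (Rabs u0 + Rabs b) T u v flow g_nonneg).
    intros t t_in. specialize (below t (all_moving t t_in)).
    destruct (moving_reaches t (all_moving t t_in)) as [le_u _].
    pose proof (Rle_abs b). pose proof (Rabs_pos b). pose proof (Rabs_pos u0).
    pose proof (Rle_abs (- u0)) as opp_le. rewrite Rabs_Ropp in opp_le. apply Rabs_le. lra. }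
  split; [exact global|]. intros t t_nonneg. apply all_moving. rewrite global. now split.
Qed.

Lemma halts_at_infinity (b : R) :
  (forall t, 0 <= t -> moving T v t) -> (forall t, moving T v t -> u t < b) ->
  exists x, x <= b /\ halts T u v x.
Proof.
  intros all_moving below.
  destruct (completeness (fun y => exists t, 0 <= t /\ u t = y)) as [x [ub_x lub_x]].
  { exists b. intros y [t [t_nonneg <-]]. now apply Rlt_le, below, all_moving. }
  { exists (u 0), 0. split; [lra|reflexivity]. }
  assert (u_le : forall t, 0 <= t -> u t <= x) by (intros t t_nonneg; apply ub_x; now exists t).
  exists x. split.
  { apply lub_x. intros y [t [t_nonneg <-]]. now apply Rlt_le, below, all_moving. }
  split.
  - intros t [t_in _]. assert (t_nonneg : 0 <= t) by apply t_in.
    apply Rlt_le_trans with (u (t + 1)); [|apply u_le; lra].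
    apply moving_increasing; [apply all_moving|]; lra.
  - intros eps eps_pos.
    assert (exists r, 0 <= r /\ x - eps < u r) as [r [r_nonneg near]].
    { apply NNPP. intros none. assert (x <= x - eps); [|lra].
      apply lub_x. intros y [t [t_nonneg <-]]. apply Rnot_lt_le. intros lt_u.
      apply none. now exists t. }
    apply NNPP. intros fast.
    assert (v_ge : forall t, r <= t -> eps <= v t).
    { intros t le_rt. apply Rnot_lt_le. intros slow. apply fast. exists t.
      split; [apply all_moving; lra|]. split; [|exact slow].
      destruct le_rt as [lt_rt|<-]; [|exact near].
      apply Rlt_trans with (u r); [exact near|].
      apply moving_increasing; [apply all_moving; lra|lra]. }
    destruct (mean_value u v r (r + 1)) as [c [c_in slope]]; [lra| |].
    { intros t t_in. apply (flow_duffing flow), all_moving. lra. }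
    specialize (v_ge c ltac:(lra)). specialize (u_le (r + 1) ltac:(lra)). lra.
Qed.

Lemma passes_or_stalls (b : R) :
  0 <= g -> u0 <= b ->
  (exists s, moving T v s /\ u s = b) \/ exists x, x <= b /\ stalls g x.
Proof.
  intros g_nonneg le_b.
  destruct (classic (exists s, moving T v s /\ b <= u s)) as [[s [mov le_us]]|none].
  { left. apply (moving_position s b mov). lra. }
  right.
  assert (below : forall s, moving T v s -> u s < b).
  { intros s mov. apply Rnot_le_lt. intros le_us. apply none. now exists s. }
  destruct (classic (exists t, forward_interval T t /\ v t <= 0)) as [[t [t_in v_nonpos]]|v_pos].
  - destruct (stops_halts t t_in v_nonpos) as [s [_ [_ halt]]].
    exists (u s). split; [|now apply halts_stalls].
    apply Rnot_lt_le. intros lt_b. destruct (proj2 halt (u s - b) ltac:(lra)) as [r [mov [near _]]].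
    specialize (below r mov). lra.
  - destruct (moving_bounded_global b g_nonneg) as [_ all_moving]; [|exact below|].
    { intros t t_in. apply Rnot_le_lt. intros v_le. apply v_pos. now exists t. }
    destruct (halts_at_infinity b all_moving below) as [x [le_x halt]].
    exists x. split; [exact le_x|now apply halts_stalls].
Qed.

Lemma reaches_moving (x y : R) :
  0 <= g -> reaches g x y -> exists s, moving T v s /\ u s = x /\ v s = y.
Proof.
  intros g_nonneg reach.
  destruct (passes_or_stalls x g_nonneg (proj1 reach)) as [[s [mov here]]|[z [le_z stall]]].
  - exists s. split; [exact mov|]. split; [exact here|].
    pose proof (moving_reaches s mov) as reach'. rewrite here in reach'.
    now apply (reaches_unique g x).
  - pose proof (stalls_crosses_lt g g z x (Rle_refl g) stall ltac:(now exists y)). lra.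
Qed.

End Flow.

Lemma crosses_or_stalls (g b : R) :
  0 <= g -> u0 <= b -> crosses g b \/ exists x, x <= b /\ stalls g x.
Proof.
  intros g_nonneg le_b. destruct (complete_flow_exists g u0 u1) as [T [u [v flow]]].
  destruct (passes_or_stalls g T u v flow b g_nonneg le_b) as [[s [mov <-]]|stall];
    [left|now right].
  exists (v s). now apply (moving_reaches g T u v).
Qed.

Lemma reaches_start (g : R) : reaches g u0 u1.
Proof.
  destruct (complete_flow_exists g u0 u1) as [T [u [v flow]]].
  rewrite <- (flow_position0 flow) at 1.
  rewrite <- (flow_velocity0 flow).
  apply (moving_reaches g T u v flow), (moving_start g T u v flow).
Qed.

(** * Energy along orbits *)

Lemma is_derive_orbit_energy (g b x : R) (V : R -> R) :
  orbit g b V -> u0 <= x <= b -> is_derive (fun z => energy z (V z)) x (- g * V x).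
Proof.
  intros [_ ode] x_in. destruct (ode x x_in) as [V_pos DV].
  unfold energy. derive_known. field. lra.
Qed.

Lemma reaches_energy_le (g x y z w : R) :
  0 <= g -> x <= z -> reaches g x y -> reaches g z w -> energy z w <= energy x y.
Proof.
  intros g_nonneg le_xz reach [_ [V [orb <-]]].
  assert (x_in : u0 <= x <= z) by (split; [apply reach|exact le_xz]).
  rewrite (reaches_unique g x y (V x) reach) by now apply orbit_reaches with z.
  apply Ropp_le_cancel.
  apply (derive_nonneg_le (fun r => - energy r (V r)) (fun r => - (- g * V r))); [exact le_xz| |];
    intros r r_in.
  - apply (is_derive_opp (fun r => energy r (V r))).
    apply (is_derive_orbit_energy g z); [exact orb|lra].
  - assert (0 < V r) by (apply orb; lra). nra.
Qed.

Lemma reaches_energy_conserved (x y : R) : reaches 0 x y -> energy x y = energy u0 u1.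
Proof.
  intros [le_x [V [orb <-]]]. rewrite <- (proj1 orb).
  apply Rle_antisym; [apply Ropp_le_cancel|].
  - apply (derive_nonneg_le (fun r => - energy r (V r)) (fun r => - (- 0 * V r))); [exact le_x| |];
      intros r r_in; [|lra].
    apply (is_derive_opp (fun r => energy r (V r))). now apply (is_derive_orbit_energy 0 x).
  - apply (derive_nonneg_le (fun r => energy r (V r)) (fun r => - 0 * V r)); [exact le_x| |];
      intros r r_in; [|lra]. now apply (is_derive_orbit_energy 0 x).
Qed.

(* Along an orbit [dE/du = - g v], and [2 v >= |1 - u^2|] above the saddle energy. *)
Lemma reaches_dissipation (g e x y z w : R) :
  0 <= g -> Rabs e <= 1 -> x <= z -> reaches g x y -> reaches g z w -> 1 / 4 <= energy z w ->
  energy z w + g * (e * ((z - z ^ 3 / 3) - (x - x ^ 3 / 3)) / 2) <= energy x y.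
Proof.
  intros g_nonneg e_le le_xz reach reach_z high. assert (reach_z' := reach_z).
  destruct reach_z' as [_ [V [orb V_z]]]. rewrite <- V_z in *.
  assert (x_in : u0 <= x <= z) by (split; [apply reach|exact le_xz]).
  rewrite (reaches_unique g x y (V x) reach) by now apply orbit_reaches with z.
  set (f := fun r => - (energy r (V r) + g * (e * (r - r ^ 3 / 3) / 2))).
  assert (mono : f x <= f z); [|unfold f in mono; lra].
  apply (derive_nonneg_le f (fun r => g * (V r - e * (1 - r ^ 2) / 2))); [exact le_xz| |];
    intros r r_in.
  - destruct (proj2 orb r ltac:(lra)) as [V_pos DV].
    unfold f, energy. derive_known. field. lra.
  - apply Rmult_le_pos; [exact g_nonneg|].
    assert (V_pos : 0 < V r) by (apply orb; lra).
    assert (fast : Rabs (1 - r ^ 2) <= 2 * V r).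
    { apply velocity_lower_bound; [|lra]. apply Rle_trans with (1 := high).
      apply (reaches_energy_le g); [exact g_nonneg|lra| |exact reach_z].
      apply orbit_reaches with z; [exact orb|lra]. }
    assert (Rabs (e * (1 - r ^ 2)) <= 1 * (2 * V r)).
    { rewrite Rabs_mult. apply Rmult_le_compat; try apply Rabs_pos; assumption. }
    pose proof (Rle_abs (e * (1 - r ^ 2))). lra.
Qed.

Lemma crosses_saddle_energy (g a x y : R) :
  0 <= g -> saddle a -> x <= a -> crosses g a -> reaches g x y -> 1 / 4 < energy x y.
Proof.
  intros g_nonneg sad le_xa [w reach_a] reach.
  pose proof (reaches_energy_le g x y a w g_nonneg le_xa reach reach_a).
  pose proof (reaches_velocity_pos g a w reach_a).
  rewrite energy_saddle in * by exact sad. assert (0 < w ^ 2) by now apply pow_lt. lra.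
Qed.

Lemma stalls_energy (g x eps : R) :
  stalls g x -> 0 < eps ->
  exists z y, reaches g z y /\ x - eps < z < x /\ Rabs (energy z y - energy x 0) < eps.
Proof.
  intros [bound approach] eps_pos.
  destruct (continuous_eps (fun z => energy z 0) x (eps / 2)) as [d [d_pos near]]; [|lra|].
  { apply (ex_derive_continuous (fun z => energy z 0)). unfold energy. auto_derive. exact I. }
  set (r := Rmin (Rmin 1 d) eps).
  assert (r_le : r <= Rmin 1 d /\ r <= eps) by (split; [apply Rmin_l|apply Rmin_r]).
  assert (r_le' : Rmin 1 d <= 1 /\ Rmin 1 d <= d) by (split; [apply Rmin_l|apply Rmin_r]).
  destruct (approach r) as [z [y [reach [near_x slow]]]]; [repeat apply Rmin_glb_lt; lra|].
  assert (lt_zx : z < x) by (apply bound; now exists y).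
  pose proof (reaches_velocity_pos g z y reach).
  exists z, y. split; [exact reach|]. split; [lra|].
  specialize (near z ltac:(apply Rabs_def1; lra)). apply Rabs_def2 in near.
  replace (energy z y) with (energy z 0 + y ^ 2 / 2) by (unfold energy; field).
  assert (0 <= y ^ 2 < eps) by nra. apply Rabs_def1; lra.
Qed.

Lemma stalls_energy_le (g x z y : R) :
  0 <= g -> stalls g x -> reaches g z y -> energy x 0 <= energy z y.
Proof.
  intros g_nonneg stall reach. apply Rnot_lt_le. intros low.
  assert (lt_zx : z < x) by (apply (proj1 stall); now exists y).
  destruct (stalls_energy g x (Rmin (x - z) (energy x 0 - energy z y)) stall)
    as [z' [y' [reach' [z'_in near]]]]; [apply Rmin_glb_lt; lra|].
  pose proof (Rmin_l (x - z) (energy x 0 - energy z y)).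
  pose proof (Rmin_r (x - z) (energy x 0 - energy z y)).
  pose proof (reaches_energy_le g z y z' y' g_nonneg ltac:(lra) reach reach').
  apply Rabs_def2 in near. lra.
Qed.

Lemma stalls_reaches_low (g x l : R) :
  stalls g x -> ~ saddle x -> l < x ->
  exists z y, l < z < x /\ reaches g z y /\ energy z y < 1 / 4.
Proof.
  intros stall not_saddle lt_l. pose proof (energy_rest_lt x not_saddle).
  destruct (stalls_energy g x (Rmin (x - l) (1 / 4 - energy x 0)) stall)
    as [z [y [reach [z_in near]]]]; [apply Rmin_glb_lt; lra|].
  pose proof (Rmin_l (x - l) (1 / 4 - energy x 0)).
  pose proof (Rmin_r (x - l) (1 / 4 - energy x 0)).
  apply Rabs_def2 in near. exists z, y. split; [lra|]. split; [exact reach|lra].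
Qed.

(** * Stability in the damping *)

Lemma orbit_dist_le (g g' b m P : R) (V Q : R -> R) :
  orbit g b V -> orbit g' b Q -> u0 <= b -> 0 < m ->
  (forall x, u0 <= x <= b -> m <= V x /\ m <= Q x) ->
  (forall x, u0 <= x <= b -> Rabs (x - x ^ 3) <= P) ->
  Rabs (Q b - V b) <= Rabs (g' - g) * exp ((P / m ^ 2 + 1) * (b - u0)).
Proof.
  intros orb_V orb_Q le_b m_pos fast force.
  assert (b_in : u0 <= b <= b) by lra.
  destruct (Rle_dec g g') as [le_g|lt_g].
  - pose proof (orbit_le g g' b V Q orb_V orb_Q b le_g b_in).
    rewrite Rabs_minus_sym, !Rabs_pos_eq by lra. now apply (orbit_gap_le g g').
  - pose proof (orbit_le g' g b Q V orb_Q orb_V b ltac:(lra) b_in).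
    rewrite (Rabs_minus_sym g'), !Rabs_pos_eq by lra.
    apply (orbit_gap_le g' g); try assumption; [lra|]. intros x x_in. now apply and_comm, fast.
Qed.

Lemma orbit_stable (g g' b c m P r : R) (V Q : R -> R) :
  orbit g b V -> orbit g' b Q -> u0 <= b <= c -> 0 < r <= m ->
  (forall x, u0 <= x <= c -> 2 * m <= V x) ->
  (forall x, u0 <= x <= c -> Rabs (x - x ^ 3) <= P) ->
  Rabs (g' - g) * exp ((P / m ^ 2 + 1) * (c - u0)) < r -> Rabs (Q b - V b) < r.
Proof.
  intros orb_V orb_Q b_in r_in V_ge force small.
  assert (rate_nonneg : 0 <= P / m ^ 2 + 1).
  { assert (0 <= P) by (apply Rle_trans with (2 := force b b_in), Rabs_pos).
    assert (0 <= P / m ^ 2) by (apply Rdiv_le_0_compat; [|apply pow_lt]; lra). lra. }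
  assert (close : forall x, u0 <= x <= b -> (forall z, u0 <= z <= x -> m <= Q z) ->
    Rabs (Q x - V x) < r).
  { intros x x_in Q_ge. eapply Rle_lt_trans; [apply (orbit_dist_le g g' x m P)|].
    - now apply orbit_le_bound with b.
    - now apply orbit_le_bound with b.
    - lra.
    - lra.
    - intros z z_in. specialize (V_ge z ltac:(lra)). specialize (Q_ge z z_in). lra.
    - intros z z_in. apply force. lra.
    - apply Rle_lt_trans with (2 := small). apply Rmult_le_compat_l; [apply Rabs_pos|].
      apply exp_le, Rmult_le_compat_l; lra. }
  apply close; [lra|]. intros z z_in. apply Rnot_lt_le. intros slow.
  destruct (first_hit Q u0 z m) as [x [x_in [hit before]]]; try lra.
  - intros q q_in. apply (orbit_continuous g' b); [exact orb_Q|lra].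
  - rewrite (proj1 orb_Q), <- (proj1 orb_V). specialize (V_ge u0 ltac:(lra)). lra.
  - assert (near : Rabs (Q x - V x) < r).
    { apply close; [lra|]. intros q q_in.
      destruct (Req_dec q x) as [->|ne]; [lra|]. apply Rlt_le, before. lra. }
    specialize (V_ge x ltac:(lra)). apply Rabs_def2 in near. lra.
Qed.

Lemma reaches_stable (g x y eps : R) :
  reaches g x y -> 0 < eps ->
  exists d, 0 < d /\ forall g', 0 <= g' -> Rabs (g' - g) < d ->
    exists y', reaches g' x y' /\ Rabs (y' - y) < eps.
Proof.
  intros [le_x [V [orb_V <-]]] eps_pos.
  destruct (orbit_velocity_min g x V orb_V le_x) as [m [m_pos V_ge]].
  destruct (continuous_bounded (fun z => z - z ^ 3) u0 x le_x) as [P [P_pos force]].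
  { intros z _. apply (ex_derive_continuous (fun z => z - z ^ 3)). auto_derive. exact I. }
  set (amplification := exp ((P / (m / 2) ^ 2 + 1) * (x - u0))).
  assert (amplification_pos : 0 < amplification) by apply exp_pos.
  set (r := Rmin (m / 2) eps).
  assert (r_le : r <= m / 2 /\ r <= eps) by (split; [apply Rmin_l|apply Rmin_r]).
  assert (r_pos : 0 < r) by (apply Rmin_glb_lt; lra).
  exists (r / amplification). split; [now apply Rdiv_lt_0_compat|].
  intros g' g'_nonneg near.
  assert (close : forall z Q, u0 <= z <= x -> orbit g' z Q -> Rabs (Q z - V z) < r).
  { intros z Q z_in orb_Q. apply (orbit_stable g g' z x (m / 2) P r V Q).
    - apply orbit_le_bound with x; [lra|exact orb_V].
    - exact orb_Q.
    - exact z_in.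
    - lra.
    - intros q q_in. specialize (V_ge q q_in). lra.
    - exact force.
    - apply (Rmult_lt_compat_r amplification) in near; [|exact amplification_pos].
      replace (r / amplification * amplification) with r in near by (field; lra). exact near. }
  destruct (crosses_or_stalls g' x g'_nonneg le_x) as [[y' reach]|[z [le_z [bound approach]]]].
  - exists y'. split; [exact reach|]. destruct reach as [_ [Q [orb_Q <-]]].
    specialize (close x Q ltac:(lra) orb_Q). lra.
  - exfalso. destruct (approach (m / 2) ltac:(lra)) as [w [q [reach [_ slow]]]].
    assert (w < z) by (apply bound; now exists q). destruct reach as [le_w [Q [orb_Q <-]]].
    specialize (close w Q ltac:(lra) orb_Q). specialize (V_ge w ltac:(lra)).
    apply Rabs_def2 in close. lra.
Qed.

Lemma crosses_open (g x : R) :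
  crosses g x ->
  exists d, 0 < d /\ forall g', 0 <= g' -> Rabs (g' - g) < d -> crosses g' x.
Proof.
  intros [y reach]. destruct (reaches_stable g x y 1 reach ltac:(lra)) as [d [d_pos near]].
  exists d. split; [exact d_pos|]. intros g' g'_nonneg close.
  destruct (near g' g'_nonneg close) as [y' [reach' _]]. now exists y'.
Qed.

Lemma crosses_antitone (g g' x : R) : 0 <= g <= g' -> crosses g' x -> crosses g x.
Proof.
  intros g_in cross. assert (le_x : u0 <= x) by (destruct cross as [y reach]; apply reach).
  destruct (crosses_or_stalls g x ltac:(lra) le_x) as [|[z [le_z stall]]]; [assumption|].
  pose proof (stalls_crosses_lt g g' z x ltac:(lra) stall cross). lra.
Qed.

Lemma stalls_stable (g x eps : R) :
  stalls g x -> 0 < eps ->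
  exists d, 0 < d /\ forall g', 0 <= g' -> Rabs (g' - g) < d ->
    exists z y, z < x /\ reaches g' z y /\ energy z y < energy x 0 + eps.
Proof.
  intros stall eps_pos.
  destruct (stalls_energy g x (eps / 2) stall ltac:(lra)) as [z [y [reach [z_in low]]]].
  destruct (continuous_eps (energy z) y (eps / 2)) as [r [r_pos near_y]]; [|lra|].
  { apply (ex_derive_continuous (energy z)). unfold energy. auto_derive. exact I. }
  destruct (reaches_stable g z y r reach r_pos) as [d [d_pos near_g]].
  exists d. split; [exact d_pos|]. intros g' g'_nonneg close.
  destruct (near_g g' g'_nonneg close) as [y' [reach' close_y]].
  exists z, y'. split; [lra|]. split; [exact reach'|].
  specialize (near_y y' close_y). apply Rabs_def2 in near_y. apply Rabs_def2 in low. lra.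
Qed.

(** * Thresholds *)

Lemma saddle_neighbourhood (a : R) :
  saddle a -> u0 < a ->
  exists y, u0 < y < a /\ forall x, y <= x <= a -> 0 <= x - x ^ 3 /\ a - x <= Rabs (1 - x ^ 2).
Proof.
  intros [-> | ->] lt_a.
  - exists ((Rmax u0 0 + 1) / 2). pose proof (Rmax_l u0 0). pose proof (Rmax_r u0 0).
    assert (Rmax u0 0 < 1) by (apply Rmax_lub_lt; lra). split; [lra|].
    intros x x_in. split; [|rewrite Rabs_pos_eq; nra].
    replace (x - x ^ 3) with (x * ((1 - x) * (1 + x))) by ring. repeat apply Rmult_le_pos; lra.
  - exists ((u0 - 1) / 2). split; [lra|]. intros x x_in. split; [|rewrite Rabs_left1; nra].
    replace (x - x ^ 3) with (- x * ((- x - 1) * (- x + 1))) by ring.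
    repeat apply Rmult_le_pos; lra.
Qed.

(* Near the saddle the gap between the orbits of [g] and [g'] cannot shrink, yet both velocities
   would tend to zero. *)
Lemma stalls_saddle_unique (g g' a : R) :
  saddle a -> g < g' -> stalls g a -> stalls g' a -> False.
Proof.
  intros sad lt_g stall stall'.
  destruct (saddle_neighbourhood a sad (stalls_gt_start g a stall)) as [y [y_in near]].
  destruct (stalls_crosses g a y stall ltac:(lra)) as [vy reach_vy].
  destruct (stalls_crosses g' a y stall' ltac:(lra)) as [qy reach_qy].
  pose proof (reaches_lt g g' y vy qy lt_g ltac:(lra) reach_vy reach_qy) as gap.
  destruct (proj2 stall (Rmin (vy - qy) (a - y))) as [z [vz [reach_vz [z_gt slow]]]];
    [apply Rmin_glb_lt; lra|].
  pose proof (Rmin_l (vy - qy) (a - y)). pose proof (Rmin_r (vy - qy) (a - y)).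
  assert (lt_z : z < a) by (apply (proj1 stall); now exists vz).
  destruct (stalls_crosses g' a z stall' ltac:(lra)) as [qz reach_qz].
  assert (vy - qy <= vz - qz).
  { apply (reaches_gap_nondecreasing g g' y z); try assumption; [lra|lra|].
    intros x x_in. apply near. lra. }
  pose proof (reaches_velocity_pos g' z qz reach_qz). lra.
Qed.

Lemma stalls_beyond_saddle (g g' a : R) :
  saddle a -> 0 <= g < g' -> stalls g a -> exists x, u0 < x < a /\ stalls g' x.
Proof.
  intros sad lt_g stall. pose proof (stalls_gt_start g a stall).
  destruct (crosses_or_stalls g' a) as [cross|[x [le_x stall']]]; [lra|lra| |].
  - pose proof (stalls_crosses_lt g g' a a ltac:(lra) stall cross). lra.
  - exists x. split; [|exact stall']. split; [now apply (stalls_gt_start g')|].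
    destruct le_x as [lt_x| ->]; [exact lt_x|].
    exfalso. now apply (stalls_saddle_unique g g' a).
Qed.

Lemma crosses_undamped (b : R) : 1 / 4 < energy u0 u1 -> u0 <= b -> crosses 0 b.
Proof.
  intros high le_b. destruct (crosses_or_stalls 0 b (Rle_refl 0) le_b) as [|[x [_ stall]]];
    [assumption|exfalso].
  destruct (stalls_energy 0 x (energy u0 u1 - 1 / 4) stall ltac:(lra)) as [z [y [reach [_ near]]]].
  rewrite (reaches_energy_conserved z y reach) in near. pose proof (energy_rest_le x).
  apply Rabs_def2 in near. lra.
Qed.

Lemma saddle_passage_cost (a : R) :
  saddle a -> u0 < a ->
  exists x e, u0 <= x < a /\ Rabs e <= 1 /\ 0 < e * ((a - a ^ 3 / 3) - (x - x ^ 3 / 3)).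
Proof.
  intros [-> | ->] lt_a.
  - exists (Rmax u0 (-1)), 1. pose proof (Rmax_l u0 (-1)). pose proof (Rmax_r u0 (-1)).
    assert (Rmax u0 (-1) < 1) by (apply Rmax_lub_lt; lra). set (x := Rmax u0 (-1)) in *.
    split; [lra|]. split; [rewrite Rabs_R1; lra|].
    replace (1 * _) with ((1 - x) ^ 2 * (x + 2) / 3) by field.
    apply Rdiv_lt_0_compat; [|lra]. apply Rmult_lt_0_compat; [apply pow_lt|]; lra.
  - exists u0, (-1). split; [lra|]. split; [rewrite Rabs_left; lra|].
    replace (-1 * _) with ((u0 + 1) ^ 2 * (2 - u0) / 3) by field.
    apply Rdiv_lt_0_compat; [|lra]. apply Rmult_lt_0_compat; [|lra].
    replace ((u0 + 1) ^ 2) with ((- u0 - 1) ^ 2) by ring. apply pow_lt. lra.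
Qed.

Lemma crosses_saddle_bounded (a : R) :
  saddle a -> u0 < a -> exists G, forall g, 0 <= g -> crosses g a -> g <= G.
Proof.
  intros sad lt_a. destruct (saddle_passage_cost a sad lt_a) as [x [e [x_in [e_le cost_pos]]]].
  set (cost := e * ((a - a ^ 3 / 3) - (x - x ^ 3 / 3))) in *.
  exists (2 * (energy u0 u1 - 1 / 4) / cost). intros g g_nonneg cross.
  destruct (crosses_le g a x cross ltac:(lra)) as [y reach].
  pose proof (reaches_energy_le g u0 u1 x y g_nonneg ltac:(lra) (reaches_start g) reach).
  assert (cross' := cross). destruct cross' as [w reach_a].
  pose proof (crosses_saddle_energy g a a w g_nonneg sad (Rle_refl a) cross reach_a).
  pose proof (reaches_dissipation g e x y a w g_nonneg e_le ltac:(lra) reach reach_a ltac:(lra))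
    as dissipation. fold cost in dissipation.
  apply Rmult_le_reg_r with cost; [exact cost_pos|].
  replace (2 * (energy u0 u1 - 1 / 4) / cost * cost) with (2 * (energy u0 u1 - 1 / 4))
    by (field; lra). lra.
Qed.

(* If all smaller dampings cross [a], the critical one cannot stall earlier: near a stall at
   [x <> -1] their energy would already be below [1 / 4], and the passage from [-1] to [1] costs
   an energy of at least [2 g / 3]. *)
Lemma stalls_of_crosses_below (g a x : R) :
  saddle a -> 0 < g -> (forall g', 0 <= g' < g -> crosses g' a) -> stalls g x -> x <= a -> x = a.
Proof.
  intros sad g_pos below stall le_x. apply NNPP. intros ne.
  assert (low_below : forall eps, 0 < eps -> exists g' z y,
    g / 2 <= g' < g /\ z < x /\ reaches g' z y /\ energy z y < energy x 0 + eps).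
  { intros eps eps_pos. destruct (stalls_stable g x eps stall eps_pos) as [d [d_pos near]].
    set (h := Rmin d g / 2). pose proof (Rmin_l d g). pose proof (Rmin_r d g).
    assert (0 < Rmin d g) by (apply Rmin_glb_lt; lra).
    destruct (near (g - h)) as [z [y [lt_z [reach low]]]]; [unfold h; lra| |].
    { apply Rabs_def1; unfold h; lra. }
    exists (g - h), z, y. split; [unfold h; lra|]. now split. }
  destruct (classic (saddle x)) as [sad_x|not_saddle].
  - destruct sad as [-> | ->]; destruct sad_x as [-> | ->]; try lra.
    destruct (low_below (g / 3) ltac:(lra)) as [g' [z [y [g'_in [lt_z [reach low]]]]]].
    rewrite (energy_saddle (-1)) in low by now right.
    pose proof (below g' ltac:(lra)) as cross. assert (le_z := proj1 reach).
    destruct (crosses_le g' 1 (-1) cross ltac:(lra)) as [w reach_w].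
    destruct cross as [q reach_q].
    pose proof (crosses_saddle_energy g' 1 1 q ltac:(lra) (or_introl eq_refl) (Rle_refl 1)
      ltac:(now exists q) reach_q).
    pose proof (reaches_energy_le g' z y (-1) w ltac:(lra) ltac:(lra) reach reach_w).
    pose proof (reaches_dissipation g' 1 (-1) w 1 q ltac:(lra) ltac:(rewrite Rabs_R1; lra)
      ltac:(lra) reach_w reach_q ltac:(lra)). lra.
  - destruct (low_below (1 / 4 - energy x 0)) as [g' [z [y [g'_in [lt_z [reach low]]]]]].
    { pose proof (energy_rest_lt x not_saddle). lra. }
    pose proof (crosses_saddle_energy g' a z y ltac:(lra) sad ltac:(lra)
      (below g' ltac:(lra)) reach). lra.
Qed.

Definition saddle_threshold (a gamma : R) : Prop :=
  0 <= gamma /\ forall g, 0 <= g ->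
    (crosses g a <-> g < gamma) /\ (g = gamma -> stalls g a) /\
    (gamma < g -> exists x, u0 < x < a /\ stalls g x).

Lemma supercritical_threshold (a : R) :
  1 / 4 < energy u0 u1 -> saddle a -> u0 < a ->
  exists gamma, saddle_threshold a gamma.
Proof.
  intros high sad lt_a. destruct (crosses_saddle_bounded a sad lt_a) as [G bound].
  destruct (antitone_open_threshold (fun g => crosses g a) G) as [gamma [gamma_pos threshold]].
  - apply crosses_undamped; [exact high|lra].
  - exact bound.
  - intros g g'. apply crosses_antitone.
  - intros g _. apply crosses_open.
  - assert (stall : stalls gamma a).
    { destruct (crosses_or_stalls gamma a) as [cross|[x [le_x stall]]]; [lra|lra| |].
      - apply threshold in cross; lra.
      - replace a with x; [exact stall|].
        apply (stalls_of_crosses_below gamma); try assumption.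
        intros g' g'_in. apply threshold; lra. }
    exists gamma. split; [lra|]. intros g g_nonneg.
    split; [now apply threshold|]. split; [now intros ->|].
    intros lt_g. apply (stalls_beyond_saddle gamma); [exact sad|lra|exact stall].
Qed.

Lemma critical_threshold (a : R) :
  energy u0 u1 = 1 / 4 -> saddle a -> u0 < a -> (forall b, saddle b -> u0 < b -> a <= b) ->
  saddle_threshold a 0.
Proof.
  intros critical sad lt_a first.
  assert (no_cross : forall g, 0 <= g -> ~ crosses g a).
  { intros g g_nonneg cross.
    pose proof (crosses_saddle_energy g a u0 u1 g_nonneg sad ltac:(lra) cross (reaches_start g)).
    lra. }
  assert (stall : stalls 0 a).
  { destruct (crosses_or_stalls 0 a) as [cross|[x [le_x stall]]]; [lra|lra| |].
    - contradiction (no_cross 0 (Rle_refl 0) cross).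
    - assert (sad_x : saddle x).
      { apply NNPP. intros not_saddle.
        destruct (stalls_reaches_low 0 x u0 stall not_saddle (stalls_gt_start 0 x stall))
          as [z [y [_ [reach low]]]].
        rewrite (reaches_energy_conserved z y reach) in low. lra. }
      replace a with x; [exact stall|]. apply Rle_antisym; [exact le_x|].
      apply first; [exact sad_x|]. now apply (stalls_gt_start 0). }
  split; [lra|]. intros g g_nonneg. split; [|split].
  - split; [intros cross; contradiction (no_cross g g_nonneg cross)|lra].
  - now intros ->.
  - intros lt_g. apply (stalls_beyond_saddle 0); [exact sad|lra|exact stall].
Qed.

Lemma saddle_threshold_exists (a : R) :
  1 / 4 <= energy u0 u1 -> saddle a -> u0 < a ->
  (energy u0 u1 = 1 / 4 -> forall b, saddle b -> u0 < b -> a <= b) ->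
  exists gamma, saddle_threshold a gamma /\ (energy u0 u1 = 1 / 4 -> gamma = 0).
Proof.
  intros [high|critical] sad lt_a first.
  - destruct (supercritical_threshold a high sad lt_a) as [gamma threshold].
    exists gamma. split; [exact threshold|lra].
  - exists 0. split; [|reflexivity]. apply critical_threshold; auto.
Qed.

Lemma ordered_saddle_thresholds :
  1 / 4 < energy u0 u1 -> u0 < -1 ->
  exists gamma0 gamma1, gamma0 < gamma1 /\
    saddle_threshold 1 gamma0 /\ saddle_threshold (-1) gamma1.
Proof.
  intros high u0_lt.
  destruct (supercritical_threshold 1 high (or_introl eq_refl) ltac:(lra)) as [gamma0 right_saddle].
  destruct (supercritical_threshold (-1) high (or_intror eq_refl) u0_lt) as [gamma1 left_saddle].
  exists gamma0, gamma1. split; [|now split].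
  destruct right_saddle as [gamma0_nonneg right_saddle].
  apply (proj2 left_saddle gamma0 gamma0_nonneg).
  apply (stalls_crosses gamma0 1); [|lra]. now apply (right_saddle gamma0 gamma0_nonneg).
Qed.

(** * Fate of maximal solutions *)

Section MaximalSolution.

Variables (g : R) (T : Rbar) (u v : R -> R).
Hypothesis g_nonneg : 0 <= g.
Hypothesis maximal : maximal_duffing_solution g u0 u1 T u v.

Lemma reaches_enters (S : R -> R -> Prop) (x y : R) :
  reaches g x y -> S x y -> enters S T u v.
Proof.
  intros reach S_xy.
  destruct (maximal_complete_flow g u0 u1 T u v maximal) as [u' [v' [flow same]]].
  destruct (reaches_moving g T u' v' flow x y g_nonneg reach) as [s [[s_in _] [at_x at_y]]].
  exists s. split; [exact s_in|]. destruct (same s (proj1 s_in)) as [<- <-].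
  now rewrite at_x, at_y.
Qed.

Lemma reaches_blows_up (x y : R) :
  reaches g x y -> 1 <= x \/ (x < -1 /\ energy x y < 1 / 4) -> blows_up T.
Proof.
  intros reach escape.
  destruct (maximal_complete_flow g u0 u1 T u v maximal) as [u' [v' [flow _]]].
  destruct (reaches_moving g T u' v' flow x y g_nonneg reach) as [s [mov [at_x at_y]]].
  pose proof (reaches_velocity_pos g x y reach).
  destruct T as [tau| |]; [exact I|exfalso|exact I].
  assert (global : forall t, s <= t -> duffing_at g u' v' t).
  { intros t le_st. apply (flow_duffing flow). split; [|exact I].
    apply Rle_trans with s; [apply mov|exact le_st]. }
  rewrite <- at_x, <- at_y in *. destruct escape as [outward|[left_side low]].
  - now apply (outward_blowup g s u' v').
  - now apply (Kminus_left_blowup g s u' v').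
Qed.

Lemma crosses_one_enters : crosses g 1 -> enters N1 T u v /\ blows_up T.
Proof.
  intros [y reach]. pose proof (reaches_velocity_pos g 1 y reach). split.
  - apply (reaches_enters N1 1 y reach). unfold N1, Nset.
    rewrite energy_saddle by now left. pose proof (pow2_ge_0 y). lra.
  - apply (reaches_blows_up 1 y reach). left. lra.
Qed.

Lemma stalls_left_enters (x : R) :
  x < -1 -> stalls g x -> enters Kminus_left T u v /\ blows_up T.
Proof.
  intros x_lt stall.
  destruct (stalls_reaches_low g x u0 stall) as [z [y [z_in [reach low]]]].
  { intros [-> | ->]; lra. }
  { now apply (stalls_gt_start g). }
  split.
  - apply (reaches_enters Kminus_left z y reach).
    split; [split; [exact low|rewrite Rabs_left; lra]|lra].
  - apply (reaches_blows_up z y reach). right. split; lra.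
Qed.

Lemma stalls_well_converges (x : R) :
  0 < g -> -1 < x < 1 -> stalls g x -> converges_exponentially 0 0 T u v.
Proof.
  intros g_pos x_in stall.
  destruct (stalls_reaches_low g x (-1) stall) as [z [y [z_in [reach low]]]].
  { intros [-> | ->]; lra. }
  { lra. }
  destruct (maximal_complete_flow g u0 u1 T u v maximal) as [u' [v' [flow same]]].
  apply (converges_exponentially_ext 0 0 T u v u' v' same).
  destruct (reaches_moving g T u' v' flow z y g_nonneg reach) as [s [[s_in _] [at_z at_y]]].
  rewrite <- at_z, <- at_y in *.
  assert (inside : Rabs (u' s) < 1) by (apply Rabs_def1; lra).
  assert (global : T = p_infty).
  { destruct (duffing_at_bounded g 0 s u' v' (proj1 s_in)) as [M [M_pos bound]].
    { intros t t_in. now apply (flow_duffing_upto g T u' v' flow s). }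
    apply (bounded_position_global g u0 u1 (M + 1) T u' v' flow g_nonneg). intros t t_in.
    destruct (Rle_dec t s) as [le_ts|lt_st].
    - destruct (bound t (conj (proj1 t_in) le_ts)). lra.
    - assert (Rabs (u' t) < 1); [|lra].
      apply (well_invariant g s t u' v'); try assumption; [lra|]. intros r r_in.
      apply (flow_duffing_upto g T u' v' flow t); [exact t_in|].
      assert (0 <= s) by apply s_in. lra. }
  rewrite global in *. apply (well_convergence g s u' v' g_pos); try assumption; [apply s_in|].
  intros t t_nonneg. now apply (flow_duffing flow).
Qed.

(* The motion cannot stop at a saddle in finite time, by backward uniqueness of the equilibrium. *)
Lemma stalls_saddle_moving (a : R) (u' v' : R -> R) :
  complete_flow g u0 u1 T u' v' -> saddle a -> stalls g a ->
  T = p_infty /\ forall t, 0 <= t -> moving T v' t.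
Proof.
  intros flow sad stall. apply (moving_bounded_global g T u' v' flow a g_nonneg).
  - intros t t_in. apply Rnot_le_lt. intros v_nonpos.
    destruct (stops_halts g T u' v' flow t t_in v_nonpos) as [s [s_in [rest halt]]].
    assert (at_a : u' s = a).
    { apply (stalls_unique g); [|exact stall]. now apply (halts_stalls g T u' v' flow). }
    destruct (duffing_at_unique g 0 s s u' v' (fun _ => a) (fun _ => 0)) with (t := 0)
      as [_ rest0]; try assumption.
    + split; [apply s_in|apply Rle_refl].
    + intros r r_in. now apply (flow_duffing_upto g T u' v' flow s).
    + intros r _. split; [apply (is_derive_const a)|].
      replace (a ^ 3 - a - g * 0) with 0; [apply (is_derive_const 0)|].
      destruct sad as [-> | ->]; ring.
    + split; [apply Rle_refl|apply s_in].
    + rewrite (flow_velocity0 flow) in rest0. lra.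
  - intros t mov. apply (proj1 stall). exists (v' t). now apply (moving_reaches g T u' v' flow).
Qed.

Lemma stalls_saddle_converges (a : R) :
  saddle a -> stalls g a -> converges_exponentially a 0 T u v.
Proof.
  intros sad stall. destruct (maximal_complete_flow g u0 u1 T u v maximal) as [u' [v' [flow same]]].
  apply (converges_exponentially_ext a 0 T u v u' v' same).
  destruct (stalls_saddle_moving a u' v' flow sad stall) as [global all_moving].
  destruct (saddle_neighbourhood a sad (stalls_gt_start g a stall)) as [y [y_in near]].
  destruct (stalls_crosses g a y stall ltac:(lra)) as [w reach].
  destruct (reaches_moving g T u' v' flow y w g_nonneg reach) as [s [[[s_nonneg _] _] [at_y _]]].
  rewrite global. apply (saddle_convergence g a s u' v' g_nonneg s_nonneg).
  - intros t t_nonneg. apply (flow_duffing flow). now apply all_moving.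
  - intros t le_st. pose proof (all_moving t ltac:(lra)) as mov.
    pose proof (moving_reaches g T u' v' flow t mov) as reach_t.
    assert (v_pos : 0 < v' t) by (apply (reaches_velocity_pos g (u' t) (v' t) reach_t)).
    assert (u_lt : u' t < a) by (apply (proj1 stall); now exists (v' t)).
    assert (u_ge : y <= u' t).
    { rewrite <- at_y. destruct le_st as [lt_st|<-]; [|lra].
      apply Rlt_le, (moving_increasing g T u' v' flow); [exact mov|lra]. }
    assert (fast : Rabs (1 - u' t ^ 2) <= 2 * v' t).
    { apply velocity_lower_bound; [|lra].
      replace (1 / 4) with (energy a 0) by (rewrite energy_saddle by exact sad; field).
      now apply (stalls_energy_le g). }
    destruct (near (u' t) ltac:(lra)). repeat split; lra.
Qed.

Lemma outward_start_low_energy :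
  0 < g -> 1 <= u0 -> exists x y, 1 < x /\ reaches g x y /\ energy x y < 1 / 4.
Proof.
  intros g_pos u0_ge. set (h := 1 + 6 * Rabs (energy u0 u1) / g).
  assert (excess_nonneg : 0 <= 6 * Rabs (energy u0 u1) / g).
  { apply Rdiv_le_0_compat; [pose proof (Rabs_pos (energy u0 u1)); lra|exact g_pos]. }
  destruct (crosses_or_stalls g (u0 + h)) as [[y reach]|[x [le_x stall]]]; [lra|unfold h; lra| |].
  - exists (u0 + h), y. split; [unfold h; lra|]. split; [exact reach|].
    apply Rnot_le_lt. intros high.
    pose proof (reaches_dissipation g (-1) u0 u1 (u0 + h) y g_nonneg ltac:(rewrite Rabs_left; lra)
      ltac:(unfold h; lra) (reaches_start g) reach high) as dissipation.
    assert (cubic : h ^ 3 / 3 <= (u0 + h) ^ 3 / 3 - (u0 + h) - (u0 ^ 3 / 3 - u0)).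
    { assert (0 < h) by (unfold h; lra). assert (1 <= u0 ^ 2) by nra. nra. }
    assert (h <= h ^ 3) by (assert (1 <= h) by (unfold h; lra); nra).
    assert (gh : g * h = g + 6 * Rabs (energy u0 u1)) by (unfold h; field; lra).
    pose proof (Rle_abs (energy u0 u1)). nra.
  - pose proof (stalls_gt_start g x stall).
    destruct (stalls_reaches_low g x u0 stall) as [z [y [z_in [reach low]]]].
    { intros [-> | ->]; lra. }
    { assumption. }
    exists z, y. split; [lra|]. now split.
Qed.

Lemma outward_start_escapes :
  1 <= u0 -> blows_up T /\ (g > 0 -> enters Kminus_right T u v).
Proof.
  intros u0_ge. split.
  - apply (reaches_blows_up u0 u1 (reaches_start g)). now left.
  - intros g_pos. destruct (outward_start_low_energy g_pos u0_ge) as [x [y [x_gt [reach low]]]].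
    apply (reaches_enters Kminus_right x y reach).
    split; [split; [exact low|rewrite Rabs_pos_eq; lra]|exact x_gt].
Qed.

Lemma right_saddle_fate (gamma0 : R) :
  saddle_threshold 1 gamma0 ->
  (g < gamma0 -> enters N1 T u v /\ blows_up T) /\
  (g = gamma0 -> converges_exponentially 1 0 T u v) /\
  (gamma0 < g -> -1 <= u0 \/ crosses g (-1) -> converges_exponentially 0 0 T u v).
Proof.
  intros [gamma0_nonneg threshold]. destruct (threshold g g_nonneg) as [crossing [critical beyond]].
  split; [|split].
  - intros lt_g. now apply crosses_one_enters, crossing.
  - intros eq_g. apply stalls_saddle_converges; [now left|now apply critical].
  - intros gt_g start. destruct (beyond gt_g) as [x [x_in stall]].
    apply (stalls_well_converges x); [lra| |exact stall].
    destruct start as [|cross]; [lra|].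
    pose proof (stalls_crosses_lt g g x (-1) (Rle_refl g) stall cross). lra.
Qed.

Lemma left_saddle_fate (gamma1 : R) :
  saddle_threshold (-1) gamma1 ->
  (g = gamma1 -> converges_exponentially (-1) 0 T u v) /\
  (gamma1 < g -> enters Kminus_left T u v /\ blows_up T).
Proof.
  intros [_ threshold]. destruct (threshold g g_nonneg) as [_ [critical beyond]]. split.
  - intros eq_g. apply stalls_saddle_converges; [now right|now apply critical].
  - intros gt_g. destruct (beyond gt_g) as [x [x_in stall]].
    apply (stalls_left_enters x); [lra|exact stall].
Qed.

End MaximalSolution.

End Orbits.

Theorem theorem2 (u0 u1 : R) (hN : Nset u0 u1) (hu1 : u1 > 0) :
  (N1 u0 u1 ->
    forall (gamma : R) (T : Rbar) (u v : R -> R),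
      0 <= gamma -> maximal_duffing_solution gamma u0 u1 T u v ->
      blows_up T /\ (gamma > 0 -> enters Kminus_right T u v))
  /\
  (N2 u0 u1 ->
    exists gamma0 : R, gamma0 >= 0 /\
      (forall (gamma : R) (T : Rbar) (u v : R -> R),
        0 <= gamma -> maximal_duffing_solution gamma u0 u1 T u v ->
        (gamma < gamma0 -> enters N1 T u v /\ blows_up T) /\
        (gamma = gamma0 -> converges_exponentially 1 0 T u v) /\
        (gamma > gamma0 -> converges_exponentially 0 0 T u v)) /\
      (energy u0 u1 = 1 / 4 -> gamma0 = 0))
  /\
  (N3 u0 u1 -> energy u0 u1 > 1 / 4 ->
    exists gamma0 gamma1 : R, gamma1 > gamma0 /\ gamma0 >= 0 /\
      forall (gamma : R) (T : Rbar) (u v : R -> R),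
        0 <= gamma -> maximal_duffing_solution gamma u0 u1 T u v ->
        (gamma < gamma0 -> enters N1 T u v /\ blows_up T) /\
        (gamma = gamma0 -> converges_exponentially 1 0 T u v) /\
        (gamma0 < gamma < gamma1 -> converges_exponentially 0 0 T u v) /\
        (gamma = gamma1 -> converges_exponentially (-1) 0 T u v) /\
        (gamma > gamma1 -> enters Kminus_left T u v /\ blows_up T))
  /\
  (N3 u0 u1 -> energy u0 u1 = 1 / 4 ->
    forall (gamma : R) (T : Rbar) (u v : R -> R),
      0 <= gamma -> maximal_duffing_solution gamma u0 u1 T u v ->
      (gamma = 0 -> converges_exponentially (-1) 0 T u v) /\
      (gamma > 0 -> enters Kminus_left T u v /\ blows_up T)).
Proof.
  assert (high : 1 / 4 <= energy u0 u1) by now apply Rge_le.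
  split; [|split; [|split]].
  - intros [_ [_ u0_ge]] g T u v g_nonneg maximal.
    apply (outward_start_escapes u0 u1 hu1 g T u v g_nonneg maximal). lra.
  - intros [_ [_ u0_in]].
    destruct (saddle_threshold_exists u0 u1 hu1 1) as [gamma0 [threshold critical]];
      [exact high|now left|lra|intros _ b [-> | ->]; lra|].
    exists gamma0. split; [apply Rle_ge, threshold|split; [|exact critical]].
    intros g T u v g_nonneg maximal.
    destruct (right_saddle_fate u0 u1 hu1 g T u v g_nonneg maximal gamma0 threshold)
      as [below [at_threshold above]].
    split; [exact below|split; [exact at_threshold|]]. intros gt_g. apply above; lra.
  - intros [_ [_ u0_lt]] supercritical.
    destruct (ordered_saddle_thresholds u0 u1 hu1 supercritical u0_lt)
      as [gamma0 [gamma1 [lt_gamma [threshold0 threshold1]]]].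
    exists gamma0, gamma1. split; [exact lt_gamma|split; [apply Rle_ge, threshold0|]].
    intros g T u v g_nonneg maximal.
    destruct (right_saddle_fate u0 u1 hu1 g T u v g_nonneg maximal gamma0 threshold0)
      as [below [at_threshold above]].
    split; [exact below|split; [exact at_threshold|split]].
    + intros [gt_g lt_g]. apply above; [exact gt_g|]. right. now apply threshold1.
    + now apply (left_saddle_fate u0 u1 hu1 g).
  - intros [_ [_ u0_lt]] critical_energy.
    destruct (saddle_threshold_exists u0 u1 hu1 (-1)) as [gamma1 [threshold critical]];
      [exact high|now right|lra|intros _ b [-> | ->]; lra|].
    rewrite (critical critical_energy) in threshold. intros g T u v g_nonneg maximal.
    now apply (left_saddle_fate u0 u1 hu1 g).
Qed.
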